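(* Let $\mu(x),\nu(x)$ be probability densities on $\mathbb T^d$ with positive constants $m_\mu,M_\mu,m_\nu,M_\nu$ such that $\mu(x)\in[m_\mu,M_\mu]$ and $\nu(x)\in[m_\nu,M_\nu]$ for all $x\in\mathbb T^d$. Let $\varepsilon>0$ and let $(\phi_\varepsilon,\psi_\varepsilon)$ be the Schrödinger potentials for $\mathrm{EOT}_\varepsilon(\mu,\nu)$. Let $\alpha,R>0$ be the constants such that $x\mapsto\mathrm{dist}(0_d,x)^2$ is $\alpha$-strongly convex on $B_{\mathbb T^d}(0_d,R)$ (see context). Then there exist positive constants $C_\nu$ depending only on $m_\nu,M_\nu,d$ and $C_\mu$ depending only on $m_\mu,M_\mu,d$ such that for all $\chi,\eta\in\mathcal C(\mathbb T^d)$, $$\mathbb V_\mu(\chi)\le\Big(4\varepsilon+C_\nu e^{\frac{2R^2}{\alpha}+8\pi^2d}+\frac{8\,\mathrm{osc}(\chi)^2}{3\varepsilon}\Big)\big[\mathcal I^\varepsilon_{\mu,\nu}[\phi_\varepsilon]-\mathcal I^\varepsilon_{\mu,\nu}[\phi_\varepsilon+\chi]\big],$$ $$\mathbb V_\nu(\eta)\le\Big(4\varepsilon+C_\mu e^{\frac{2R^2}{\alpha}+8\pi^2d}+\frac{8\,\mathrm{osc}(\eta)^2}{3\varepsilon}\Big)\big[\overline{\mathcal I}^\varepsilon_{\mu,\nu}[\psi_\varepsilon]-\overline{\mathcal I}^\varepsilon_{\mu,\nu}[\psi_\varepsilon+\eta]\big].$$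
   Context: $\mathbb T^d=\mathbb R^d/2\pi\mathbb Z^d$ with $\mathrm{dist}(x,y)=\min_{k\in\mathbb Z^d}\|x-y-2\pi k\|$ and $B_{\mathbb T^d}(x,r)$ the open ball. For a geodesically convex $S\subset\mathbb T^d$, $f$ is $\alpha$-strongly convex on $S$ if $f(z)\le(1-\lambda)f(x_0)+\lambda f(x_1)-\frac{\alpha\lambda(1-\lambda)}2\mathrm{dist}(x_0,x_1)^2$ for all $\lambda\in[0,1]$, $x_0,x_1\in S$ and $z\in S$ with $\mathrm{dist}(z,x_0)=\lambda\,\mathrm{dist}(x_0,x_1)$, $\mathrm{dist}(z,x_1)=(1-\lambda)\mathrm{dist}(x_0,x_1)$; $\alpha,R>0$ are fixed constants for which $x\mapsto\mathrm{dist}(0_d,x)^2$ is $\alpha$-strongly convex on $B_{\mathbb T^d}(0_d,R)$. $\mathcal K_\varepsilon(x)=(2\pi\varepsilon)^{-d/2}\sum_{k}e^{-\|x-2\pi k\|^2/(2\varepsilon)}$, $c_\varepsilon(x,y)=-\varepsilon\log\mathcal K_\varepsilon(x-y)$. $\mathcal T^\varepsilon_\mu[\phi](y)=-\varepsilon\log\int e^{(\phi(x)-c_\varepsilon(x,y))/\varepsilon}d\mu(x)$, $\mathcal T^\varepsilon_\nu[\psi](x)=-\varepsilon\log\int e^{(\psi(y)-c_\varepsilon(x,y))/\varepsilon}d\nu(y)$. $\mathcal I^\varepsilon_{\mu,\nu}[\phi]=\int\phi\,d\mu+\int\mathcal T^\varepsilon_\mu[\phi]\,d\nu$ and $\overline{\mathcal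 I}^\varepsilon_{\mu,\nu}[\psi]=\int\mathcal T^\varepsilon_\nu[\psi]\,d\mu+\int\psi\,d\nu$. $\mathrm{EOT}_\varepsilon(\mu,\nu)=\min_{\pi\in\Pi(\mu,\nu)}\int c_\varepsilon d\pi+\varepsilon\mathrm{KL}(\pi\|\mu\otimes\nu)$, and the Schrödinger potentials satisfy $\phi_\varepsilon\in\arg\max\mathcal I^\varepsilon_{\mu,\nu}$, $\psi_\varepsilon\in\arg\max\overline{\mathcal I}^\varepsilon_{\mu,\nu}$, with $\phi_\varepsilon=\mathcal T^\varepsilon_\nu[\psi_\varepsilon]$, $\psi_\varepsilon=\mathcal T^\varepsilon_\mu[\phi_\varepsilon]$. $\mathbb V_\mu(f)=\int(f-\int f\,d\mu)^2d\mu$; $\mathrm{osc}(f)=\sup f-\inf f$. *)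

(* Defs.v *)
From HB Require Import structures.
From mathcomp Require Import all_boot all_order all_algebra.
From mathcomp Require Import all_classical all_reals all_analysis.
Set Implicit Arguments.
Unset Strict Implicit.
Unset Printing Implicit Defensive.
Import Order.TTheory GRing.Theory Num.Theory.
Import numFieldNormedType.Exports.
Local Open Scope classical_set_scope.
Local Open Scope ring_scope.

(* Points of T^d = R^d / 2pi Z^d are represented by points of 'rV[R]_d;
   functions on T^d are 2pi Z^d-tor_periodic functions on 'rV[R]_d. *)

Definition tor_eucl_norm {R : realType} {d : nat} (x : 'rV[R]_d) : R :=
  Num.sqrt (\sum_(i < d) x ord0 i ^+ 2).

Definition tor_lattice_pt {R : realType} {d : nat} (k : 'rV[int]_d) : 'rV[R]_d :=
  (2 * pi) *: map_mx (fun z : int => z%:~R) k.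

Definition tor_tdist {R : realType} {d : nat} (x y : 'rV[R]_d) : R :=
  inf [set tor_eucl_norm (x - y - tor_lattice_pt k) | k in [set: 'rV[int]_d]].

Definition tor_tball {R : realType} {d : nat} (x : 'rV[R]_d) (r : R) : set 'rV[R]_d :=
  [set y | tor_tdist x y < r].

Definition tor_strongly_convex_on {R : realType} {d : nat} (alpha : R)
    (S : set 'rV[R]_d) (f : 'rV[R]_d -> R) : Prop :=
  forall (lam : R) (x0 x1 z : 'rV[R]_d),
    0 <= lam <= 1 -> S x0 -> S x1 -> S z ->
    tor_tdist z x0 = lam * tor_tdist x0 x1 ->
    tor_tdist z x1 = (1 - lam) * tor_tdist x0 x1 ->
    f z <= (1 - lam) * f x0 + lam * f x1
           - alpha * lam * (1 - lam) / 2 * tor_tdist x0 x1 ^+ 2.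

Definition tor_periodic {R : realType} {d : nat} (f : 'rV[R]_d -> R) : Prop :=
  forall (x : 'rV[R]_d) (k : 'rV[int]_d), f (x + tor_lattice_pt k) = f x.

Definition tor_borel_meas {R : realType} {d : nat} (f : 'rV[R]_d -> R) : Prop :=
  forall B : set R, measurable B ->
    <<s [set U : set 'rV[R]_d | open U] >> (f @^-1` B).

Fixpoint tor_cube_intE {R : realType} (d : nat) :
    ('rV[R]_d -> \bar R) -> \bar R :=
  match d return ('rV[R]_d -> \bar R) -> \bar R with
  | 0 => fun f => f 0
  | d'.+1 => fun f =>
      (\int[@lebesgue_measure R]_(t in `[0%R, (2 * pi)%R]%classic)
         @tor_cube_intE R d' (fun v : 'rV[R]_d' => f (row_mx (const_mx t : 'rV[R]_1) v)))%E
  end.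

(* real-valued integral over T^d w.r.t. the Lebesgue (Haar, mass (2pi)^d) measure *)
Definition tor_tint {R : realType} {d : nat} (f : 'rV[R]_d -> R) : R :=
  fine (@tor_cube_intE R d (fun x => (f x)%:E)).

Definition tor_bounded_density {R : realType} {d : nat} (mu : 'rV[R]_d -> R)
    (m M : R) : Prop :=
  [/\ tor_periodic mu, tor_borel_meas mu, (forall x, m <= mu x <= M) & tor_tint mu = 1].

Definition tor_heat_kernel {R : realType} {d : nat} (eps : R) (x : 'rV[R]_d) : R :=
  powR (2 * pi * eps) (- (d%:R / 2)) *
  fine (\esum_(k in [set: 'rV[int]_d])
          (expR (- (tor_eucl_norm (x - tor_lattice_pt k) ^+ 2 / (2 * eps))))%:E)%E.

Definition tor_cost {R : realType} {d : nat} (eps : R) (x y : 'rV[R]_d) : R :=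
  - eps * ln (tor_heat_kernel eps (x - y)).

Definition tor_cT_mu {R : realType} {d : nat} (mu : 'rV[R]_d -> R) (eps : R)
    (phi : 'rV[R]_d -> R) (y : 'rV[R]_d) : R :=
  - eps * ln (tor_tint (fun x => expR ((phi x - tor_cost eps x y) / eps) * mu x)).

Definition tor_cT_nu {R : realType} {d : nat} (nu : 'rV[R]_d -> R) (eps : R)
    (psi : 'rV[R]_d -> R) (x : 'rV[R]_d) : R :=
  - eps * ln (tor_tint (fun y => expR ((psi y - tor_cost eps x y) / eps) * nu y)).

Definition tor_Ifun {R : realType} {d : nat} (mu nu : 'rV[R]_d -> R) (eps : R)
    (phi : 'rV[R]_d -> R) : R :=
  tor_tint (fun x => phi x * mu x) + tor_tint (fun y => tor_cT_mu mu eps phi y * nu y).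

Definition tor_Ibar {R : realType} {d : nat} (mu nu : 'rV[R]_d -> R) (eps : R)
    (psi : 'rV[R]_d -> R) : R :=
  tor_tint (fun x => tor_cT_nu nu eps psi x * mu x) + tor_tint (fun y => psi y * nu y).

Definition tor_schrodinger_potentials {R : realType} {d : nat}
    (mu nu : 'rV[R]_d -> R) (eps : R) (phi psi : 'rV[R]_d -> R) : Prop :=
  [/\ tor_periodic phi /\ continuous phi,
      tor_periodic psi /\ continuous psi,
      (forall f, tor_periodic f -> continuous f -> tor_Ifun mu nu eps f <= tor_Ifun mu nu eps phi),
      (forall g, tor_periodic g -> continuous g -> tor_Ibar mu nu eps g <= tor_Ibar mu nu eps psi)
    & phi = tor_cT_nu nu eps psi /\ psi = tor_cT_mu mu eps phi].

Definition tor_variance {R : realType} {d : nat} (mu f : 'rV[R]_d -> R) : R :=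
  tor_tint (fun x => (f x - tor_tint (fun y => f y * mu y)) ^+ 2 * mu x).

Definition tor_osc {R : realType} {d : nat} (f : 'rV[R]_d -> R) : R :=
  sup (range f) - inf (range f).

(* Main.v *)
Require Import Defs.
From HB Require Import structures.
From mathcomp Require Import all_boot all_order all_algebra.
From mathcomp Require Import all_classical all_reals all_analysis.
From mathcomp Require Import measurable_realfun ring lra.
Set Implicit Arguments.
Unset Strict Implicit.
Unset Printing Implicit Defensive.
Import Order.TTheory GRing.Theory Num.Theory.
Import numFieldNormedType.Exports.
Local Open Scope classical_set_scope.
Local Open Scope ring_scope.

(** Write [T f] for the soft transform [tor_cT_mu mu eps f]. By Young's
    inequality, applied to the lattice sum defining the heat kernel and to the
    integral against [mu], [T f y - |y|^2 / 2] is jointly concave in [(f, y)].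
    Put [g0 = T phi], [g1 = T (phi + chi)], [u = g1 - g0] and let [dl >= 0] be
    the midpoint defect [T (phi + chi / 2) - (g0 + g1) / 2]. Joint concavity
    gives [dl z >= (g0 (z - w) - g0 z + g1 (z + w) - g1 z - |w|^2) / 2] for all
    [w]. On a circle the [g]'s are Lipschitz, being periodic and semiconcave, so
    integrating this over an arc and optimizing over [w] bounds the squared
    oscillation of [u] by [48 pi] times the integral of [dl]. Applied on the
    coordinate lines, this bounds the variance of [u] on the torus by a
    dimensional constant times the integral of [dl], and maximality of [phi]
    bounds the integral of [dl] against [nu] by half the gap
    [I phi - I (phi + chi)].

    Let [p_y] be the conditional laws of the Schroedinger plan given [y]; their
    mixture along [nu] is [mu], and [- u y = eps log E_{p_y} exp (chi / eps)].
    The variance of [chi] under [mu] is the [nu]-mean of the variances under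
    [p_y] plus the [nu]-variance of the means [E_{p_y} chi]. The former are
    controlled by the Jensen gaps [D y = - u y - E_{p_y} chi], whose [nu]-mean is
    the gap, and the latter by [D] and the variance of [u]. *)

(** * Bounded measurable functions *)

(** One predicate for all integrands: it is stable under the operations used below and, against a
    finite measure, implies integrability, so integrals can be manipulated without further side
    conditions. *)
Definition bmeas {R : realType} {d : measure_display} {T : measurableType d}
    (f : T -> R) : Prop :=
  measurable_fun [set: T] f /\ exists M, forall x, `|f x| <= M.

Section bmeas_closure.
Context {R : realType} {d : measure_display} {T : measurableType d}.
Implicit Types f g : T -> R.

Lemma eq_bmeas f g : f =1 g -> bmeas f -> bmeas g.
Proof. by move=> /funext ->. Qed.

Lemma bmeas_cst (c : R) : bmeas (fun _ : T => c).
Proof. by split; [exact: measurable_cst|exists `|c|]. Qed.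

Lemma bmeasD f g : bmeas f -> bmeas g -> bmeas (fun x => f x + g x).
Proof.
move=> [mf [M fM]] [mg [N gN]]; split; first exact: measurable_funD.
exists (M + N) => x; rewrite (le_trans (ler_normD _ _))//; exact: lerD.
Qed.

Lemma bmeasM f g : bmeas f -> bmeas g -> bmeas (fun x => f x * g x).
Proof.
move=> [mf [M fM]] [mg [N gN]]; split; first exact: measurable_funM.
by exists (M * N) => x; rewrite normrM ler_pM.
Qed.

Lemma bmeasZ (c : R) f : bmeas f -> bmeas (fun x => c * f x).
Proof. exact/bmeasM/bmeas_cst. Qed.

Lemma bmeasB f g : bmeas f -> bmeas g -> bmeas (fun x => f x - g x).
Proof.
move=> bf bg; apply: eq_bmeas (bmeasD bf (bmeasZ (-1) bg)) => x.
by rewrite mulN1r.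
Qed.

Lemma bmeas_sqr f : bmeas f -> bmeas (fun x => f x ^+ 2).
Proof. by move=> bf; under eq_fun do rewrite expr2; exact: bmeasM. Qed.

Lemma bmeas_expR f : bmeas f -> bmeas (fun x => expR (f x)).
Proof.
move=> [mf [M fM]]; split; first exact: measurableT_comp.
exists (expR M) => x; rewrite ger0_norm ?expR_ge0// ler_expR.
exact: le_trans (ler_norm _) (fM x).
Qed.

Lemma bmeas_ln f (m : R) : 0 < m -> (forall x, m <= f x) -> bmeas f ->
  bmeas (fun x => ln (f x)).
Proof.
move=> m0 mf [mef [M fM]]; split.
  by apply: measurableT_comp => //; exact: measurable_ln.
have f0 x : 0 < f x by exact: lt_le_trans (mf x).
exists (`|ln m| + `|ln M|) => x.
have M0 : 0 < M by apply: lt_le_trans (fM x); rewrite normr_gt0 gt_eqF.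
have l1 : ln m <= ln (f x) by rewrite ler_ln ?posrE.
have l2 : ln (f x) <= ln M.
  by rewrite ler_ln ?posrE// (le_trans _ (fM x))// ler_norm.
have := ler_norm (ln M); have := ler_norm (- ln m); rewrite normrN.
have := normr_ge0 (ln m); have := normr_ge0 (ln M).
rewrite ler_norml => *; apply/andP; split; lra.
Qed.

Lemma bmeasV f (m : R) : 0 < m -> (forall x, m <= f x) -> bmeas f ->
  bmeas (fun x => (f x)^-1).
Proof.
move=> m0 mf bf; have f0 x : 0 < f x by exact: lt_le_trans (mf x).
apply: eq_bmeas (bmeas_expR (bmeasZ (-1) (bmeas_ln m0 mf bf))) => x.
by rewrite mulN1r expRN lnK ?posrE.
Qed.

Lemma bmeas_comp {d' : measure_display} {T' : measurableType d'} (h : T' -> T) f :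
  measurable_fun [set: T'] h -> bmeas f -> bmeas (fun x => f (h x)).
Proof.
move=> mh [mf [M fM]]; split; last by exists M.
exact: (measurableT_comp mf mh).
Qed.

End bmeas_closure.

Section bmeas_integral.
Context {R : realType} {d : measure_display} {T : measurableType d}.
Variable mu : {finite_measure set T -> \bar R}.
Implicit Types f g : T -> R.

Lemma bmeas_integrable f : bmeas f -> mu.-integrable [set: T] (EFin \o f).
Proof.
move=> [mf [M fM]]; apply: measurable_bounded_integrable => //.
  by have := fin_num_measure mu _ (@measurableT _ T); rewrite ltey_eq => ->.
exists M; split; first by rewrite num_real.
by move=> y My x _; exact: le_trans (fM x) (ltW My).
Qed.

Lemma bmeas_integralE f : bmeas f ->
  (\int[mu]_x (f x)%:E)%E = (\int[mu]_x f x)%:E.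
Proof.
move=> bf; rewrite /Rintegral fineK//.
exact: (integrable_fin_num _ (bmeas_integrable bf)).
Qed.

Lemma bmeas_intD f g : bmeas f -> bmeas g ->
  \int[mu]_x (f x + g x) = \int[mu]_x f x + \int[mu]_x g x.
Proof. by move=> bf bg; apply: RintegralD => //; exact: bmeas_integrable. Qed.

Lemma bmeas_intB f g : bmeas f -> bmeas g ->
  \int[mu]_x (f x - g x) = \int[mu]_x f x - \int[mu]_x g x.
Proof. by move=> bf bg; apply: RintegralB => //; exact: bmeas_integrable. Qed.

Lemma bmeas_intZ (c : R) f : bmeas f ->
  \int[mu]_x (c * f x) = c * \int[mu]_x f x.
Proof. by move=> bf; apply: RintegralZl => //; exact: bmeas_integrable. Qed.

Lemma bmeas_le_int f g : bmeas f -> bmeas g -> (forall x, f x <= g x) ->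
  \int[mu]_x f x <= \int[mu]_x g x.
Proof.
by move=> bf bg fg; apply: le_Rintegral => //; exact: bmeas_integrable.
Qed.

Lemma bmeas_int_cst (c : R) : \int[mu]_x c = c * fine (mu [set: T]).
Proof. exact: Rintegral_cst. Qed.

End bmeas_integral.

(** * Fubini for bounded measurable functions *)

Section bmeas_fubini.
Context {R : realType} {d1 d2 : measure_display}.
Context {T1 : measurableType d1} {T2 : measurableType d2}.
Variables (m1 : {finite_measure set T1 -> \bar R}).
Variables (m2 : {finite_measure set T2 -> \bar R}).
Implicit Types f : T1 * T2 -> R.

Lemma bmeas_prod_integrable f : bmeas f ->
  (m1 \x m2)%E.-integrable [set: T1 * T2] (EFin \o f).
Proof.
move=> [mf [M fM]]; apply: measurable_bounded_integrable => //.
  have -> : [set: T1 * T2] = [set: T1] `*` [set: T2] by rewrite setXTT.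
  rewrite [X in (X < _)%E](_ : _ = m1 [set: T1] * m2 [set: T2])%E; last first.
    by apply: product_measure1E.
  rewrite lte_mul_pinfty//; first exact: fin_num_measure.
  by have := fin_num_measure m2 _ (@measurableT _ T2); rewrite ltey_eq => ->.
exists M; split; first by rewrite num_real.
by move=> y My x _; exact: le_trans (fM x) (ltW My).
Qed.

Lemma bmeas_pair1 f y : bmeas f -> bmeas (fun x => f (x, y)).
Proof. exact: bmeas_comp (pair2_measurable y). Qed.

Lemma bmeas_pair2 f x : bmeas f -> bmeas (fun y => f (x, y)).
Proof. exact: bmeas_comp (pair1_measurable x). Qed.

Lemma bmeas_int2 f : bmeas f -> bmeas (fun x => \int[m2]_y f (x, y)).
Proof.
move=> bf; split.
  have := measurable_fubini_F (bmeas_prod_integrable bf).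
  rewrite /fubini_F => mF.
  apply/measurable_EFinP; move: mF; congr measurable_fun.
  by apply/funext => x /=; rewrite bmeas_integralE//; exact: bmeas_pair2.
have [_ [M fM]] := bf; exists (M * fine (m2 [set: T2])) => x.
rewrite ler_norml -mulNr -!bmeas_int_cst.
have H y : - M <= f (x, y) <= M by rewrite -ler_norml.
by apply/andP; split; apply: bmeas_le_int; (try exact: bmeas_cst);
  (try exact: bmeas_pair2) => y; have /andP[] := H y.
Qed.

Lemma bmeas_int1 f : bmeas f -> bmeas (fun y => \int[m1]_x f (x, y)).
Proof.
move=> bf; split.
  have := measurable_fubini_G (bmeas_prod_integrable bf).
  rewrite /fubini_G => mF.
  apply/measurable_EFinP; move: mF; congr measurable_fun.
  by apply/funext => x /=; rewrite bmeas_integralE//; exact: bmeas_pair1.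
have [_ [M fM]] := bf; exists (M * fine (m1 [set: T1])) => y.
rewrite ler_norml -mulNr -!bmeas_int_cst.
have H x : - M <= f (x, y) <= M by rewrite -ler_norml.
by apply/andP; split; apply: bmeas_le_int; (try exact: bmeas_cst);
  (try exact: bmeas_pair1) => x; have /andP[] := H x.
Qed.

Let int2E f : bmeas f ->
  (\int[m1]_x \int[m2]_y (f (x, y))%:E)%E = (\int[m1]_x \int[m2]_y f (x, y))%:E.
Proof.
move=> bf; rewrite -bmeas_integralE; last exact: bmeas_int2.
by apply: eq_integral => x _; rewrite bmeas_integralE//; exact: bmeas_pair2.
Qed.

Lemma bmeas_fubini f : bmeas f ->
  \int[m1]_x \int[m2]_y f (x, y) = \int[m2]_y \int[m1]_x f (x, y).
Proof.
move=> bf; apply: EFin_inj; rewrite -int2E//.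
rewrite -bmeas_integralE; last exact: bmeas_int1.
rewrite (Fubini (bmeas_prod_integrable bf)).
by apply: eq_integral => x _; rewrite bmeas_integralE//; exact: bmeas_pair1.
Qed.

Lemma bmeas_prod_int f : bmeas f ->
  (\int[m1 \x m2]_z (f z)%:E)%E = (\int[m1]_x \int[m2]_y f (x, y))%:E.
Proof.
move=> bf; rewrite -int2E//.
by rewrite -(integral12_prod_meas1 (bmeas_prod_integrable bf)).
Qed.

End bmeas_fubini.

(** * Lebesgue measure on the cube *)

(** Row vectors carrying the Borel sigma-algebra that [tor_borel_meas] refers to; products of such
    types carry the product sigma-algebra. *)
Definition borelV (R : realType) (d : nat) :=
  g_sigma_algebraType [set U : set 'rV[R]_d | open U].

(** The same term as the row built in [tor_cube_intE], so the iterated integral unfolds directly to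
    it. *)
Definition row_cons {T : Type} {d : nat} (t : T) (v : 'rV[T]_d) : 'rV[T]_d.+1 :=
  row_mx (const_mx t : 'rV[T]_1) v.

Lemma row_cons0 {T : Type} {d : nat} (t : T) (v : 'rV[T]_d) i :
  row_cons t v i ord0 = t.
Proof. by rewrite mxE; case: splitP => // k _; rewrite mxE. Qed.

Lemma row_consS {T : Type} {d : nat} (t : T) (v : 'rV[T]_d) i j :
  row_cons t v i (lift ord0 j) = v i j.
Proof.
rewrite mxE; case: splitP => k /= jk; last first.
  by congr (v i _); apply/val_inj; move: jk; rewrite /bump/= => -[].
by move: (ltn_ord k); rewrite -jk.
Qed.

Section borel.
Context {R : realType}.

Lemma continuous_borelV d (f : 'rV[R]_d -> R) : continuous f ->
  measurable_fun [set: borelV R d] (f : borelV R d -> R).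
Proof.
move=> /continuousP cf; apply: (measurability _ (RGenOpens.measurableE R)).
move=> _ [_ [a [b ->] <-]]; rewrite setTI; apply: sub_sigma_algebra.
exact/cf/interval_open.
Qed.

Lemma tor_borel_measP d (f : 'rV[R]_d -> R) : tor_borel_meas f <->
  measurable_fun [set: borelV R d] (f : borelV R d -> R).
Proof.
split=> [bf _ B mB|mf B mB]; first by rewrite setTI; exact: bf.
by have := mf measurableT B mB; rewrite setTI.
Qed.

(** A countable base of the topology: balls of row vectors are cubes, hence products of
    intervals. *)
Definition rat_ball d (qn : 'rV[rat]_d * nat) : set 'rV[R]_d :=
  ball (map_mx ratr qn.1 : 'rV[R]_d) qn.2.+1%:R^-1.

Lemma ball_rVP d (x y : 'rV[R]_d) (e : R) : 0 < e ->
  ball x e y <-> forall j, ball (x ord0 j) e (y ord0 j).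
Proof.
move=> e0; split=> [[_ H] j|H]; first exact: H.
by split=> // i j; rewrite ord1; exact: H.
Qed.

Lemma open_rat_ball d (U : set 'rV[R]_d) : open U ->
  U = \bigcup_(qn in [set qn | rat_ball qn `<=` U]) rat_ball qn.
Proof.
move=> oU; apply/seteqP; split=> [x Ux|x [qn /= qnU /qnU]//].
have /nbhs_ballP[e /= e0 exU] : nbhs x U by exact: open_nbhs_nbhs.
(* Twice the radius must fit below [e]: the cube contains [x] but is centred at a rational point
   near it. *)
have [n ne] : exists n : nat, 2 * n.+1%:R^-1 <= e.
  exists (Num.truncn (2 / e)); rewrite ler_pdivrMr//.
  rewrite -ler_pdivrMl// mulrC; exact/ltW/truncnS_gt.
have n0 : 0 < n.+1%:R^-1 :> R by rewrite invr_gt0.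
have /choice[q qx] : forall i, exists r : rat, ball (x ord0 i) n.+1%:R^-1 (ratr r).
  move=> i.
  have [r] : exists r : rat, (ratr r : R) \in
      `]x ord0 i - n.+1%:R^-1, x ord0 i + n.+1%:R^-1[.
    by apply: rat_in_itvoo; rewrite ltrD2l gtrN.
  by rewrite in_itv/= => xr; exists r; rewrite /ball/= ltr_distlC.
have bq : ball x n.+1%:R^-1 (map_mx ratr (\row_i q i) : 'rV[R]_d).
  by apply/ball_rVP => // j; rewrite !mxE.
exists ((\row_i q i), n) => /=; last exact: ball_sym.
move=> y qy; apply: exU; apply: (le_ball _ (ball_triangle bq qy)).
by move: ne; rewrite (_ : 2 * _ = n.+1%:R^-1 + n.+1%:R^-1) ?mulr_natl ?mulr2n//.
Qed.

(** An open set is a countable union of rational cubes, and the preimage of a cube is a measurable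
    rectangle; so the product sigma-algebra contains the preimage of every open set. *)
Lemma measurable_row_cons d :
  measurable_fun [set: measurableTypeR R * borelV R d]
    (fun z : measurableTypeR R * borelV R d => row_cons z.1 z.2 : borelV R d.+1).
Proof.
apply: (@measurability _ _ _ (borelV R d.+1) _ _
  [set U : set 'rV[R]_d.+1 | open U]) => //.
move=> _ [U /= oU <-]; rewrite setTI (open_rat_ball oU) preimage_bigcup.
rewrite bigcup_mkcond; apply: countable_bigcupT_measurable => // -[q n] /=.
case: ifPn => // _.
pose b (x : R) : set (measurableTypeR R) := ball x n.+1%:R^-1.
rewrite [X in measurable X](_ : _ =
    b (ratr (q ord0 ord0)) `*` rat_ball (\row_i q ord0 (lift ord0 i), n)).
  apply: measurableX; first exact: measurable_ball.
  by apply: sub_sigma_algebra; exact: ball_open.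
have n0 : 0 < n.+1%:R^-1 :> R by rewrite invr_gt0.
apply/seteqP; split=> [[t v] /= /(ball_rVP _ _ n0) H|].
  split=> /=; last apply/ball_rVP => // j.
    by have := H ord0; rewrite row_cons0 mxE.
  by have := H (lift ord0 j); rewrite row_consS !mxE.
move=> [t v] [/= H1 /(ball_rVP _ _ n0) H2]; apply/ball_rVP => // j.
case: (unliftP ord0 j) => [k|] ->; last by rewrite row_cons0 mxE.
by have := H2 k; rewrite row_consS !mxE.
Qed.

End borel.

Section cube_measure.
Context {R : realType}.

(** Lebesgue measure concentrated on one period but defined on the whole line; it is finite, so
    bounded functions are integrable over the full space. *)
Definition circ : set (measurableTypeR R) -> \bar R :=
  mrestr (@lebesgue_measure R) (measurable_itv `[0, 2 * pi]).

HB.instance Definition _ := Measure.on circ.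

Let circ_fin : fin_num_fun circ.
Proof.
move=> A mA; rewrite ge0_fin_numE//.
apply: (@le_lt_trans _ _ (lebesgue_measure `[0, 2 * pi]%classic)).
  by apply: le_measure; rewrite ?inE//; apply: measurableI.
by rewrite lebesgue_measure_itv/=; case: ifP => // _; rewrite -EFinB ltry.
Qed.

HB.instance Definition _ := @Measure_isFinite.Build _ _ _ circ circ_fin.

Definition circle_meas : {finite_measure set (measurableTypeR R) -> \bar R} := circ.

Section step.
Variables (d : nat) (m : {finite_measure set (borelV R d) -> \bar R}).

Definition cons_cube : set (borelV R d.+1) -> \bar R :=
  pushforward (circle_meas \x m)%E
    (fun z : measurableTypeR R * borelV R d => row_cons z.1 z.2 : borelV R d.+1).

Let cons_cube0 : cons_cube set0 = 0%E.
Proof. by rewrite /cons_cube /pushforward preimage_set0 measure0. Qed.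

Let cons_cube_ge0 A : (0 <= cons_cube A)%E.
Proof. by rewrite /cons_cube /pushforward; exact: measure_ge0. Qed.

Let cons_cube_sigma_additive : semi_sigma_additive cons_cube.
Proof.
have := @measure_semi_sigma_additive _ _ _
  (measure_function_pushforward__canonical__measure_function_Measure
    (circle_meas \x m)%E (@measurable_row_cons R d)).
exact.
Qed.

HB.instance Definition _ := isMeasure.Build _ _ _ cons_cube
  cons_cube0 cons_cube_ge0 cons_cube_sigma_additive.

Let cons_cube_fin : fin_num_fun cons_cube.
Proof.
move=> A mA; rewrite ge0_fin_numE//.
apply: (@le_lt_trans _ _ (cons_cube [set: borelV R d.+1])).
  by apply: le_measure; rewrite ?inE.
rewrite /cons_cube /pushforward preimage_setT.
rewrite [X in (X < _)%E](_ : _ = circle_meas setT * m setT)%E; last first.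
  by rewrite -product_measure1E// setXTT.
rewrite lte_mul_pinfty//; first exact: fin_num_measure.
by have := fin_num_measure m _ (@measurableT _ (borelV R d)); rewrite ltey_eq => ->.
Qed.

HB.instance Definition _ := @Measure_isFinite.Build _ _ _ cons_cube cons_cube_fin.

Definition cons_meas : {finite_measure set (borelV R d.+1) -> \bar R} := cons_cube.

End step.

(** Mirrors the recursion of [tor_cube_intE]; in dimension 0 the cube is a point of mass 1. *)
Fixpoint cube_meas d : {finite_measure set (borelV R d) -> \bar R} :=
  match d with
  | 0 => @dirac _ (borelV R 0) (0 : 'rV[R]_0) R
  | d'.+1 => cons_meas (cube_meas d')
  end.

Lemma cube_meas_int_cons d (f : borelV R d.+1 -> R) : bmeas f ->
  \int[cube_meas d.+1]_x f x =
  \int[circle_meas]_t \int[cube_meas d]_v f (row_cons t v).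
Proof.
move=> bf; apply: EFin_inj.
have bg : bmeas (fun z : measurableTypeR R * borelV R d => f (row_cons z.1 z.2)).
  exact: bmeas_comp (@measurable_row_cons R d) bf.
rewrite -bmeas_integralE// -(bmeas_prod_int _ _ bg).
rewrite -[RHS](@integral_pushforward _ _ _ _ _ _ (@measurable_row_cons R d)
  (circle_meas \x cube_meas d)%E setT (EFin \o f))//.
- by have [/measurable_EFinP] := bf.
- rewrite preimage_setT; exact: (bmeas_prod_integrable _ _ bg).
Qed.

Lemma circle_intE (f : measurableTypeR R -> R) : bmeas f ->
  (\int[circle_meas]_t (f t)%:E =
   \int[lebesgue_measure]_(t in `[0%R, (2 * pi)%R]) (f t)%:E)%E.
Proof.
move=> bf.
have mD : measurable (`[0, 2 * pi]%classic : set (measurableTypeR R)).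
  exact: measurable_itv.
have mDC : measurable (~` `[0, 2 * pi]%classic : set (measurableTypeR R)).
  exact: measurableC.
rewrite [LHS](@negligible_integral _ _ _ circle_meas setT (~` `[0, 2 * pi])
  (EFin \o f)) //.
- rewrite setTD setCK; apply: eq_measure_integral => A mA AD.
  by rewrite /= /circ /mrestr setIidl.
- exact: bmeas_integrable.
- by rewrite /= /circ /mrestr setICl measure0.
Qed.

Lemma circle_int (f : measurableTypeR R -> R) : bmeas f ->
  \int[circle_meas]_t f t = \int[lebesgue_measure]_(t in `[0, 2 * pi]) f t.
Proof. by move=> bf; rewrite /Rintegral circle_intE. Qed.

Lemma circle_measT : fine (circle_meas setT) = 2 * pi :> R.
Proof.
rewrite /= /circ /mrestr setTI lebesgue_measure_itv/= lte_fin.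
by rewrite mulr_gt0 ?pi_gt0//= subr0.
Qed.

End cube_measure.

Section tint.
Context {R : realType}.

(** Bridge from the iterated integral of the statement to an integral against a measure, where
    Fubini and monotonicity apply. *)
Lemma cube_intE_int d (f : borelV R d -> R) : bmeas f ->
  tor_cube_intE (fun x => (f x)%:E) = (\int[cube_meas d]_x f x)%:E.
Proof.
elim: d f => [f bf|d IH f bf] /=.
  rewrite -bmeas_integralE//= integral_dirac//=; last first.
    by have [/measurable_EFinP] := bf.
  by rewrite diracT mul1e.
have bg : bmeas (fun z : measurableTypeR R * borelV R d => f (row_cons z.1 z.2)).
  exact: bmeas_comp (@measurable_row_cons R d) bf.
rewrite -/(cube_meas d.+1) cube_meas_int_cons//.
have b1 := bmeas_int2 circle_meas (cube_meas d) bg.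
rewrite -bmeas_integralE// circle_intE//.
apply: eq_integral => t _; rewrite IH//.
exact: (bmeas_pair2 t bg).
Qed.

Lemma tor_tintE d (f : borelV R d -> R) : bmeas f ->
  tor_tint f = \int[cube_meas d]_x f x.
Proof. by move=> bf; rewrite /tor_tint cube_intE_int. Qed.

End tint.

(** * The periodized heat kernel *)

(** Young's inequality in exponential form: the graph lies above its tangent at the weighted mean
    [m], and the linear terms cancel. *)
Lemma expR_conv {R : realType} (l p q : R) : 0 <= l <= 1 ->
  expR ((1 - l) * p + l * q) <= (1 - l) * expR p + l * expR q.
Proof.
move=> /andP[l0 l1]; set m := _ + l * q.
have tangent x : expR m * (1 + (x - m)) <= expR x.
  have -> : expR x = expR m * expR (x - m) by rewrite -expRD addrC subrK.
  by rewrite ler_pM2l ?expR_gt0 ?expR_ge1Dx.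
have hp := tangent p; have hq := tangent q.
have e0 := expR_gt0 m.
have -> : expR m = (1 - l) * (expR m * (1 + (p - m))) + l * (expR m * (1 + (q - m))).
  by rewrite /m; ring.
by apply: lerD; apply: ler_wpM2l => //; rewrite subr_ge0.
Qed.

(** * Summability over integer lattices *)

Section esum_extra.
Context {R : realType} {T : choiceType}.
Local Open Scope ereal_scope.

Lemma esumZl (S : set T) (a : T -> \bar R) (r : R) : (0 <= r)%R ->
  (forall i, 0 <= a i) ->
  \esum_(i in S) (r%:E * a i) = r%:E * \esum_(i in S) a i.
Proof.
move=> r0 a0; rewrite /esum -ereal_supZl//; last first.
  by apply/set0P; exists 0, set0; [exact: fsets_set0|rewrite fsbig_set0].
congr ereal_sup; apply/seteqP; split=> x.
  move=> [A /= FA <-]; exists (\sum_(x \in A) a x); first by exists A.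
  by rewrite ge0_mule_fsumr.
move=> [_ [A /= FA <-] <-]; exists A => //.
by rewrite ge0_mule_fsumr.
Qed.

End esum_extra.

Lemma esum_nat_geometric_le {R : realType} (r : R) : 0 <= r < 1 ->
  (\esum_(n in [set: nat]) (r ^+ n)%:E <= ((1 - r)^-1)%:E)%E.
Proof.
move=> /andP[r0 r1]; have rn n : (0 <= (r ^+ n)%:E)%E by rewrite lee_fin exprn_ge0.
rewrite -nneseries_esumT//; apply: lime_le; first exact: is_cvg_nneseries.
apply: nearW => n; rewrite sumEFin lee_fin.
rewrite -[leRHS]mul1r ler_pdivlMr ?subr_gt0// big_mkord.
rewrite mulrC -opprB mulNr -subrX1 opprB gerBl.
exact: exprn_ge0.
Qed.

Lemma esum_int_geometric_fin {R : realType} (r : R) : 0 <= r < 1 ->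
  (\esum_(j in [set: int]) (r ^+ `|j|%N)%:E < +oo)%E.
Proof.
move=> r01; have /andP[r0 r1] := r01.
have rn n : (0 <= (r ^+ n)%:E)%E by rewrite lee_fin exprn_ge0.
have G := le_lt_trans (esum_nat_geometric_le r01) (ltry _).
rewrite (esumID (range Posz))// !setTI lte_add_pinfty//.
  by rewrite esum_image//= => m n _ _ [].
rewrite (_ : ~` range Posz = range Negz); last first.
  apply/seteqP; split=> [[n|n]//= H|_ [n _ <-] /= [m _]//].
    by exfalso; apply: H; exists n.
  by exists n.
rewrite esum_image//=; last by move=> m n _ _ [].
apply: le_lt_trans G; apply: le_esum => n _.
rewrite lee_fin [leLHS]exprS -[leRHS]mul1r ler_wpM2r ?exprn_ge0//.
exact: ltW.
Qed.

(** Tonelli, one coordinate at a time: the lattice sum is the [d]-th power of the one-dimensional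
    sum. *)
Lemma esum_rV_prod_fin {R : realType} (b : int -> R) (d : nat) :
  (forall j, 0 <= b j) -> (\esum_(j in [set: int]) (b j)%:E < +oo)%E ->
  (\esum_(k in [set: 'rV[int]_d]) (\prod_(i < d) b (k ord0 i))%:E < +oo)%E.
Proof.
move=> b0 bfin; elim: d => [|d IH].
  rewrite (_ : [set: 'rV[int]_0] = [set 0]); last first.
    by apply/seteqP; split=> // k _; rewrite /= (thinmx0 k).
  by rewrite esum_set1 big_ord0 ?ltry// lee_fin.
have p0 n (k : 'rV[int]_n) : 0 <= \prod_(i < n) b (k ord0 i) by apply: prodr_ge0.
rewrite (@reindex_esum _ _ _ ([set: int] `*`` (fun=> [set: 'rV[int]_d])) _
  (fun z => row_cons z.1 z.2)); last first.
  split => //.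
    move=> [j k] [j' k'] _ _ /= E; congr pair.
      by have := congr1 (fun M : 'rV__ => M ord0 ord0) E; rewrite !row_cons0.
    apply/rowP => i; have := congr1 (fun M : 'rV__ => M ord0 (lift ord0 i)) E.
    by rewrite !row_consS.
  move=> k _; exists (k ord0 ord0, \row_i k ord0 (lift ord0 i)) => //=.
  apply/rowP => i; case: (unliftP ord0 i) => [j|] ->.
    by rewrite row_consS mxE.
  by rewrite row_cons0.
rewrite (eq_esum (b := fun z : int * 'rV[int]_d =>
    ((b z.1)%:E * (\prod_(i < d) b (z.2 ord0 i))%:E)%E)); last first.
  move=> z _ /=; rewrite big_ord_recl row_cons0 EFinM; congr (_ * _%:E)%E.
  by apply: eq_bigr => i _; rewrite row_consS.
rewrite -(esum_esum (a := fun j (k : 'rV[int]_d) =>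
    ((b j)%:E * (\prod_(i < d) b (k ord0 i))%:E)%E)); last first.
  by move=> j k _ _; rewrite mule_ge0 ?lee_fin.
have S0 : (0 <= \esum_(k in [set: 'rV[int]_d]) (\prod_(i < d) b (k ord0 i))%:E)%E.
  by apply: esum_ge0 => k _; rewrite lee_fin.
move: IH S0; set S := (X in (X < _)%E) => IH S0.
have SE : S = (fine S)%:E by rewrite fineK// ge0_fin_numE.
rewrite (eq_esum (b := fun j => ((fine S)%:E * (b j)%:E)%E)); last first.
  move=> j _; rewrite esumZl//; last by move=> k; rewrite lee_fin.
  by rewrite -/S [in LHS]SE muleC.
have fS0 : 0 <= fine S by exact: fine_ge0.
rewrite esumZl//.
exact: lte_mul_pinfty.
Qed.

(** * Squared norm and lattice translations *)

Section sqnorm.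
Context {R : realType} {d : nat}.

Definition sqnorm {d} (x : 'rV[R]_d) : R := \sum_(i < d) x ord0 i ^+ 2.

Lemma sqnorm_ge0 (x : 'rV[R]_d) : 0 <= sqnorm x.
Proof. by apply: sumr_ge0 => i _; exact: sqr_ge0. Qed.

Lemma tor_eucl_norm_sqr (x : 'rV[R]_d) : tor_eucl_norm x ^+ 2 = sqnorm x.
Proof. by rewrite sqr_sqrtr// sqnorm_ge0. Qed.

Lemma sqnormN (x : 'rV[R]_d) : sqnorm (- x) = sqnorm x.
Proof. by apply: eq_bigr => i _; rewrite mxE sqrrN. Qed.

(** Stewart's identity, coordinate by coordinate. The correction term does not involve [c], so it is
    the same for every lattice point. *)
Lemma sqnorm_conv (l : R) (a b c : 'rV[R]_d) :
  sqnorm ((1 - l) *: a + l *: b - c) =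
  (1 - l) * sqnorm (a - c) + l * sqnorm (b - c) - l * (1 - l) * sqnorm (a - b).
Proof.
rewrite /sqnorm !mulr_sumr -big_split/= -sumrB; apply: eq_bigr => i _.
by rewrite !mxE; ring.
Qed.

Lemma sqnorm_cons (t : R) (v : 'rV[R]_d) :
  sqnorm (row_cons t v) = t ^+ 2 + sqnorm v.
Proof.
rewrite /sqnorm big_ord_recl row_cons0; congr (_ + _).
by apply: eq_bigr => i _; rewrite row_consS.
Qed.

End sqnorm.

Section lattice.
Context {R : realType} {d : nat}.

Lemma lattice_ptE (k : 'rV[int]_d) i : (tor_lattice_pt k : 'rV[R]_d) ord0 i =
  2 * pi * (k ord0 i)%:~R.
Proof. by rewrite !mxE. Qed.

Lemma lattice_ptD (k m : 'rV[int]_d) :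
  tor_lattice_pt (k + m) = tor_lattice_pt k + tor_lattice_pt m :> 'rV[R]_d.
Proof. by rewrite /tor_lattice_pt -scalerDr -map_mxD. Qed.

Lemma lattice_ptN (k : 'rV[int]_d) :
  tor_lattice_pt (- k) = - tor_lattice_pt k :> 'rV[R]_d.
Proof. by rewrite /tor_lattice_pt map_mxN scalerN. Qed.

Lemma lattice_pt0 : tor_lattice_pt 0 = 0 :> 'rV[R]_d.
Proof. by apply/rowP => i; rewrite lattice_ptE !mxE mulr0. Qed.

Lemma cube_repr (z : 'rV[R]_d) : exists (k : 'rV[int]_d) (w : 'rV[R]_d),
  z = w + tor_lattice_pt k /\ forall i, 0 <= w ord0 i <= 2 * pi.
Proof.
have p0 : 0 < 2 * pi :> R by rewrite mulr_gt0// pi_gt0.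
pose k : 'rV[int]_d := \row_i Num.floor (z ord0 i / (2 * pi)).
exists k, (z - tor_lattice_pt k); split; first by rewrite subrK.
move=> i; rewrite mxE [X in _ + X]mxE lattice_ptE mxE.
have /andP[] := floor_itv (z ord0 i / (2 * pi)).
rewrite ler_pdivlMr// ltr_pdivrMr// intrD mulrDl mul1r => h1 h2.
by apply/andP; split; move: h1 h2; set u := _%:~R => h1 h2; nra.
Qed.

End lattice.

Section heat_kernel.
Context {R : realType} {d : nat}.
Variables (eps : R) (eps0 : 0 < eps).

Let gauss (z : 'rV[R]_d) (k : 'rV[int]_d) : R :=
  expR (- (sqnorm (z - tor_lattice_pt k) / (2 * eps))).

(** The lattice sum stays in the extended reals until [theta_fin] shows it finite; [fine] would send
    an infinite sum to 0. *)
Let theta (z : 'rV[R]_d) : \bar R := (\esum_(k in [set: 'rV[int]_d]) (gauss z k)%:E)%E.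

Let c0 : R := powR (2 * pi * eps) (- (d%:R / 2)).

Let c0_gt0 : 0 < c0.
Proof. by rewrite powR_gt0// !mulr_gt0// pi_gt0. Qed.

Let kernelE z : tor_heat_kernel eps z = c0 * fine (theta z).
Proof.
congr (_ * fine _); apply: eq_esum => k _.
by rewrite /gauss tor_eucl_norm_sqr.
Qed.

Let theta_ge z k : ((gauss z k)%:E <= theta z)%E.
Proof.
apply: esum_ge; exists [set k]; first by split.
by rewrite fsbig_set1.
Qed.

Let theta_ge0 z : (0 <= theta z)%E.
Proof. by apply: esum_ge0 => k _; rewrite lee_fin expR_ge0. Qed.

Let thetaDl z m : theta (z + tor_lattice_pt m) = theta z.
Proof.
rewrite /theta (@reindex_esum _ _ _ setT _ (fun k => k + m)); last first.
  split=> //; first by move=> k l _ _; exact: addIr.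
  by move=> k _; exists (k - m) => //; rewrite subrK.
apply: eq_esum => k _; rewrite /gauss.
have -> // : z + tor_lattice_pt m - tor_lattice_pt (k + m) = z - tor_lattice_pt k.
by rewrite lattice_ptD opprD addrA addrAC addrK.
Qed.

Let thetaN z : theta (- z) = theta z.
Proof.
rewrite /theta (@reindex_esum _ _ _ setT _ (fun k => - k)); last first.
  split=> [//|k l _ _|k _]; first exact: oppr_inj.
  by exists (- k) => //; rewrite opprK.
apply: eq_esum => k _; rewrite /gauss.
by rewrite lattice_ptN -[- z - _]opprD sqnormN.
Qed.

Let rr : R := expR (- (2 * eps)^-1).

(** A geometric majorant uniform over one period: for [0 <= s <= 2 * pi], the squared distance from
    [s] to [2 * pi * j] is at least [|j| - 1]. *)
Let bnd (j : int) : R := expR (2 * eps)^-1 * rr ^+ `|j|%N.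

Let gauss1_le (s : R) (j : int) : 0 <= s <= 2 * pi ->
  expR (- ((s - 2 * pi * j%:~R) ^+ 2 / (2 * eps))) <= bnd j.
Proof.
move=> /andP[s0 s1]; rewrite /bnd /rr -expRM_natl -expRD ler_expR.
have -> : (2 * eps)^-1 + `|j|%:R * - (2 * eps)^-1 = - ((`|j|%:R - 1) / (2 * eps)).
  by rewrite mulrN mulrBl mul1r opprB.
rewrite lerN2 ler_pM2r ?invr_gt0 ?mulr_gt0//.
have p1 : 1 <= pi :> R by apply: le_trans (pi_ge2 R); rewrite ler1n.
case: j => n; last first.
  rewrite NegzE abszN /= mulrNz -pmulrn mulrN opprK.
  have n1 : 1 <= n.+1%:R :> R by rewrite ler1n.
  set t := n.+1%:R in n1 *; have h : t <= s + 2 * pi * t by nra.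
  by set w := s + _ in h *; nra.
rewrite /= -pmulrn; case: n => [|[|n]].
- by rewrite sub0r (le_trans (lerN10 _))// sqr_ge0.
- by rewrite subrr sqr_ge0.
have n2 : 2 <= n.+2%:R :> R by rewrite ler_nat.
set t := n.+2%:R in n2 *.
have h : t - 1 <= 2 * pi * t - s by nra.
rewrite -sqrrN opprB; set w := (_ - s) in h *; nra.
Qed.

(** A Gaussian of a squared norm factors over the coordinates, so the one-dimensional majorants
    multiply. *)
Let theta_cube_fin (B := (\esum_(k in [set: 'rV[int]_d])
    (\prod_(i < d) bnd (k ord0 i))%:E)%E) (z : 'rV[R]_d) :
  (forall i, 0 <= z ord0 i <= 2 * pi) -> (theta z <= B)%E.
Proof.
move=> z01; apply: le_esum => k _; rewrite lee_fin /gauss /sqnorm.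
rewrite mulr_suml -sumrN expR_sum; apply: ler_prod => i _.
by rewrite expR_ge0/= !mxE; exact: gauss1_le (z01 i).
Qed.

Let bnd_fin : (\esum_(k in [set: 'rV[int]_d])
  (\prod_(i < d) bnd (k ord0 i))%:E < +oo)%E.
Proof.
have r01 : 0 <= rr < 1.
  by rewrite expR_ge0/= expR_lt1 oppr_lt0 invr_gt0 mulr_gt0.
apply: esum_rV_prod_fin => [j|]; first by rewrite mulr_ge0 ?exprn_ge0 ?expR_ge0.
under eq_esum do rewrite EFinM.
rewrite esumZl ?expR_ge0//; last by move=> j; rewrite lee_fin exprn_ge0// expR_ge0.
by apply: lte_mul_pinfty; rewrite ?lee_fin ?expR_ge0//; exact: esum_int_geometric_fin.
Qed.

Let theta_le z : (theta z <= \esum_(k in [set: 'rV[int]_d])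
  (\prod_(i < d) bnd (k ord0 i))%:E)%E.
Proof.
by have [k [w [-> w01]]] := cube_repr z; rewrite thetaDl; exact: theta_cube_fin.
Qed.

Let theta_fin z : theta z \is a fin_num.
Proof. by rewrite ge0_fin_numE// (le_lt_trans (theta_le z)). Qed.

Lemma heat_kernel_periodic : tor_periodic (@tor_heat_kernel R d eps).
Proof. by move=> x k; rewrite !kernelE thetaDl. Qed.

Lemma heat_kernelN z : tor_heat_kernel eps (- z) = @tor_heat_kernel R d eps z.
Proof. by rewrite !kernelE thetaN. Qed.

Lemma heat_kernel_ub : exists M : R, forall z : 'rV[R]_d, tor_heat_kernel eps z <= M.
Proof.
exists (c0 * fine (\esum_(k in [set: 'rV[int]_d])
  (\prod_(i < d) bnd (k ord0 i))%:E)%E) => z.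
rewrite kernelE ler_pM2l// fine_le// ge0_fin_numE//.
exact: le_trans (theta_ge0 z) (theta_le z).
Qed.

(** After translation into one period, the term [k = 0] alone gives the bound. *)
Lemma heat_kernel_lb : exists2 m : R, 0 < m &
  forall z : 'rV[R]_d, m <= tor_heat_kernel eps z.
Proof.
exists (c0 * expR (- (\sum_(i < d) (2 * pi) ^+ 2 / (2 * eps)))).
  by rewrite mulr_gt0 ?expR_gt0.
move=> z; have [k [w [-> w01]]] := cube_repr z; rewrite heat_kernel_periodic.
rewrite kernelE ler_pM2l// -lee_fin fineK//; apply: le_trans (theta_ge w 0).
rewrite lee_fin ler_expR lerN2 lattice_pt0 subr0 mulr_suml ler_sum// => i _.
rewrite ler_pM2r ?invr_gt0 ?mulr_gt0//.
by have /andP[w0 w1] := w01 i; rewrite ler_sqr ?nnegrE// (le_trans w0).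
Qed.

Lemma heat_kernel_gt0 (z : 'rV[R]_d) : 0 < tor_heat_kernel eps z.
Proof. by have [m m0 mK] := heat_kernel_lb; exact: lt_le_trans (mK z). Qed.

(** By [sqnorm_conv] each Gaussian at the intermediate point is a weighted geometric mean of the
    Gaussians at [a] and [b], times a factor common to all lattice points. Hoelder's inequality for
    the lattice sum, proved by Young's inequality termwise, concludes. *)
Lemma heat_kernel_log_semiconvex (l : R) (a b : 'rV[R]_d) : 0 <= l <= 1 ->
  ln (tor_heat_kernel eps ((1 - l) *: a + l *: b)) <=
  (1 - l) * ln (tor_heat_kernel eps a) + l * ln (tor_heat_kernel eps b)
  + l * (1 - l) * sqnorm (a - b) / (2 * eps).
Proof.
move=> l01; have /andP[l0 l1] := l01.
have A0 := heat_kernel_gt0 a; have B0 := heat_kernel_gt0 b.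
have Z0 := heat_kernel_gt0 ((1 - l) *: a + l *: b).
move: A0 B0 Z0; rewrite !kernelE !pmulr_rgt0//.
set A := fine _; set B := fine _; set Z := fine _ => A0 B0 Z0.
rewrite !lnM ?posrE//; set cor := _ / _.
suff : Z <= expR ((1 - l) * ln A + l * ln B + cor).
  by rewrite -{1}(lnK Z0) ler_expR; lra.
set E := expR _; rewrite -lee_fin /Z fineK//.
(* Dividing by [A] and [B] normalizes both sums, so this majorant adds up to
   [E * (1 - l) + E * l = E]. *)
apply: (@le_trans _ _ (\esum_(k in [set: 'rV[int]_d])
   ((E * (1 - l) / A)%:E * (gauss a k)%:E + (E * l / B)%:E * (gauss b k)%:E))%E).
  apply: le_esum => k _; rewrite -!EFinM -EFinD lee_fin.
  set al := sqnorm (a - tor_lattice_pt k) / (2 * eps).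
  set be := sqnorm (b - tor_lattice_pt k) / (2 * eps).
  have -> : gauss ((1 - l) *: a + l *: b) k =
      E * expR ((1 - l) * (- al - ln A) + l * (- be - ln B)).
    rewrite /E -expRD /gauss sqnorm_conv; congr expR.
    rewrite /al /be /cor; move: (sqnorm _) (sqnorm _) (sqnorm _) (_^-1).
    by move: (ln A) (ln B) => *; ring.
  have -> : E * (1 - l) / A * gauss a k = E * ((1 - l) * expR (- al - ln A)).
    by rewrite expRB lnK ?posrE// /gauss -/al; move: (expR _) (A^-1) => *; ring.
  have -> : E * l / B * gauss b k = E * (l * expR (- be - ln B)).
    by rewrite expRB lnK ?posrE// /gauss -/be; move: (expR _) (B^-1) => *; ring.
  by rewrite -mulrDr ler_pM2l ?expR_gt0// expR_conv.
have cA : 0 <= E * (1 - l) / A by rewrite !mulr_ge0 ?invr_ge0 ?expR_ge0 ?subr_ge0// ltW.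
have cB : 0 <= E * l / B by rewrite !mulr_ge0 ?invr_ge0 ?expR_ge0// ltW.
have g0 z k : (0 <= (gauss z k)%:E)%E by rewrite lee_fin expR_ge0.
rewrite esumD; [|by move=> k _; rewrite mule_ge0..].
rewrite !esumZl// -/(theta a) -/(theta b).
rewrite -(fineK (theta_fin a)) -(fineK (theta_fin b)) -/A -/B -!EFinM -EFinD lee_fin.
rewrite !divfK ?gt_eqF//; lra.
Qed.

(** Each Gaussian is measurable through the coordinates of both points, and the lattice sum becomes
    a series over natural numbers. *)
Lemma measurable_heat_kernel :
  measurable_fun [set: borelV R d * borelV R d]
    (fun z : borelV R d * borelV R d => tor_heat_kernel eps (z.1 - z.2 : 'rV[R]_d)).
Proof.
have mco (i : 'I_d) : measurable_fun [set: borelV R d] (fun x : borelV R d => x ord0 i : R).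
  by apply: continuous_borelV; exact: coord_continuous.
rewrite (_ : (fun _ => _) = (fun z => c0 * fine (theta (z.1 - z.2)))); last first.
  by apply/funext => z; rewrite kernelE.
apply: measurable_funM => //; apply: measurableT_comp; first exact: fine_measurable.
(* Lattice points are enumerated by their codes; a number that codes no point contributes 0. *)
pose h n (z : borelV R d * borelV R d) : \bar R :=
  if pickle_inv n is Some k then (gauss (z.1 - z.2) k)%:E else 0%E.
have h0 n z : (0 <= h n z)%E.
  by rewrite /h; case: pickle_inv => // k; rewrite lee_fin expR_ge0.
rewrite (_ : (fun _ => _) = fun z => (\sum_(0 <= i <oo | i \in predT) h i z)%E).
  apply: ge0_emeasurable_sum => // n _; rewrite /h; case: pickle_inv => [k|]//.
  apply/measurable_EFinP; apply: measurableT_comp => //=.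
  apply: measurableT_comp => //=; apply: measurable_funM => //.
  apply: measurable_sum => i; apply: measurable_funX.
  rewrite (_ : (fun _ => _) = fun z : borelV R d * borelV R d =>
    z.1 ord0 i - z.2 ord0 i - (tor_lattice_pt k : 'rV[R]_d) ord0 i); last first.
    by apply/funext => z; rewrite !mxE.
  apply: measurable_funB => //; apply: measurable_funB.
    exact: (measurableT_comp (mco i) measurable_fst).
  exact: (measurableT_comp (mco i) measurable_snd).
apply/funext => z; rewrite nneseries_esumT//.
rewrite [RHS](_ : _ = \esum_(n in range (@pickle 'rV[int]_d)) h n z)%E.
  rewrite esum_image; last by move=> k l _ _; exact: (pcan_inj pickleK_inv).
  by apply: eq_esum => k _; rewrite /h pickleK_inv.
rewrite [RHS]esum_mkcond; apply: eq_esum => n _; case: ifPn => //.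
rewrite notin_setE /h; have := @pickle_invK 'rV[int]_d n.
by case: pickle_inv => //= k <- []; exists k.
Qed.

End heat_kernel.

(** * Oscillation on the circle *)

Section circle_lemma.
Context {R : realType}.
Local Notation leb := (@lebesgue_measure R).

(** The constant [pi] is the one that periodicity and semiconcavity produce in
    [semiconcave_circle_lip]. *)
Definition circle_lip (f : R -> R) : Prop :=
  forall z s, 0 <= s <= 2 * pi -> `|f (z + s) - f z| <= pi * s.

Lemma circle_lip_continuous f : circle_lip f -> continuous f.
Proof.
move=> lf z; apply/cvgrPdist_le => e e0.
have p0 : 0 < pi :> R := pi_gt0 R.
near=> t.
have tz : `|z - t| <= Num.min (e / pi) (2 * pi).
  near: t; apply: cvgr_dist_le; first exact: cvg_id.
  by rewrite lt_min divr_gt0//= mulr_gt0.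
move: tz; rewrite le_min ler_pdivlMr// mulrC => /andP[h1 h2].
apply: le_trans h1; have [zt|tz] := leP z t.
  move: h2; rewrite distrC (ger0_norm (_ : 0 <= t - z)) ?subr_ge0// => h2.
  by have := lf z (t - z); rewrite [z + _]addrC subrK distrC subr_ge0 zt h2; exact.
have z0 : 0 <= z - t by rewrite subr_ge0 ltW.
move: h2; rewrite (ger0_norm z0) => h2.
by have := lf t (z - t); rewrite [t + _]addrC subrK subr_ge0 (ltW tz) h2; exact.
Unshelve. all: by end_near. Qed.

Lemma cont_integrable (f : R -> R) a b : continuous f ->
  leb.-integrable `[a, b] (EFin \o f).
Proof.
move=> cf; apply: continuous_compact_integrable; first exact: segment_compact.
exact: continuous_subspaceT.
Qed.

Lemma Rintegral_shift (f : R -> R) (a b w : R) : continuous f -> a <= b ->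
  \int[leb]_(x in `[a, b]) f (x + w) = \int[leb]_(x in `[a + w, b + w]) f x.
Proof.
move=> cf ab; rewrite /Rintegral.
have dF : (fun x : R => x + w)^`()%classic = cst 1.
  apply/funext => x; rewrite derive1E; have := is_derive_shift x 1 w.
  by move=> /@derive_val.
rewrite (@integration_by_substitution_increasing R (fun x => x + w) f a b)//.
- by rewrite dF; congr fine; apply: eq_integral => x _ /=; rewrite mulr1.
- by move=> x y _ _ xy; rewrite ltrD2r.
- by rewrite dF => x _; exact: cvg_cst.
- by rewrite dF; apply/cvg_ex; exists 1; exact: cvg_cst.
- by rewrite dF; apply/cvg_ex; exists 1; exact: cvg_cst.
- have cF : continuous (fun x : R => x + w).
    by move=> x; apply: cvgD; [exact: cvg_id|exact: cvg_cst].
  split.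
  + by move=> x _; have := is_derive_shift x 1 w; move=> /@ex_derive.
  + by apply: cvg_at_right_filter; exact: cF.
  + by apply: cvg_at_left_filter; exact: cF.
- exact: continuous_subspaceT.
Qed.

Lemma cont_primitive (f : R -> R) (a0 : R) : continuous f ->
  exists P : R -> R, forall x y, a0 <= x -> x <= y ->
    \int[leb]_(t in `[x, y]) f t = P y - P x.
Proof.
move=> cf; exists (fun x => \int[leb]_(t in `[a0, x]) f t) => x y ax xy.
have fi := cont_integrable a0 y cf.
rewrite Rintegral_itvB; [|exact: fi|by rewrite bnd_simp|by rewrite bnd_simp].
rewrite Rintegral_itv_obnd_cbnd//.
apply: (integrableS _ _ _ fi) => //.
by apply: subset_itv; rewrite bnd_simp.
Qed.

Lemma Rintegral_itv_bnd (f : R -> R) (x y lo hi : R) : continuous f -> x <= y ->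
  (forall t, x <= t <= y -> lo <= f t <= hi) ->
  lo * (y - x) <= \int[leb]_(t in `[x, y]) f t <= hi * (y - x).
Proof.
move=> cf xy H.
have icst c : \int[leb]_(t in `[x, y]) c = c * (y - x).
  rewrite Rintegral_cst//= lebesgue_measure_itv/= lte_fin.
  case: ltP => //= yx; last by rewrite (_ : y = x) ?subrr//; apply/eqP; rewrite eq_le yx xy.
rewrite -!icst; apply/andP; split; apply: le_Rintegral => //;
  try exact: cont_integrable; try (by apply: cont_integrable => z; exact: cvg_cst);
  by move=> t; rewrite /= in_itv/= => /H/andP[].
Qed.

(** [dl] is only measurable, so it is compared with a continuous minorant on an arc; nonnegativity
    of [dl] lets the arc grow to the full period. *)
Lemma circle_int_ge (dl g : R -> R) (a b : R) : bmeas (dl : measurableTypeR R -> R) ->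
  (forall z, 0 <= dl z) -> continuous g -> (forall z, g z <= dl z) ->
  0 <= a -> b <= 2 * pi ->
  \int[leb]_(z in `[a, b]) g z <= \int[circle_meas]_z dl z.
Proof.
move=> bd dl0 cg gd a0 b2.
have ab2 : `[a, b]%classic `<=` (`[0, 2 * pi]%classic : set R).
  by apply: subset_itv; rewrite bnd_simp.
have mab : measurable (`[a, b]%classic : set (measurableTypeR R)) by exact: measurable_itv.
have m2 : measurable (`[0, 2 * pi]%classic : set (measurableTypeR R)) by exact: measurable_itv.
have id2 : leb.-integrable `[0, 2 * pi] (EFin \o dl).
  have [md [M dM]] := bd; apply: measurable_bounded_integrable => //.
  - by rewrite /= lebesgue_measure_itv/=; case: ifP => // _; rewrite -EFinB ltry.
  - exact: measurable_funTS.
  exists M; split; first by rewrite num_real.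
  by move=> y My x _; exact: le_trans (dM x) (ltW My).
have id : leb.-integrable `[a, b] (EFin \o dl) by exact: integrableS id2.
apply: (@le_trans _ _ (\int[leb]_(z in `[a, b]) dl z)).
  by apply: le_Rintegral => //; exact: cont_integrable.
rewrite circle_int// -lee_fin /Rintegral !fineK; last 2 first.
- exact: (integrable_fin_num m2 id2).
- exact: (integrable_fin_num mab id).
apply: ge0_subset_integral => //; first by have /integrableP[] := id2.
by move=> x _; rewrite lee_fin.
Qed.

Section circle_osc.
Variables f0 f1 dl : R -> R.
Hypotheses (lf0 : circle_lip f0) (lf1 : circle_lip f1).
Hypothesis bdl : bmeas (dl : measurableTypeR R -> R).
Hypothesis dlP : forall z w,
  2^-1 * (f0 (z - w) - f0 z + (f1 (z + w) - f1 z) - w ^+ 2) <= dl z.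

(* Integrating [dlP] over [a, b] telescopes, up to O(w^2), to [w (u b - u a) / 2];
   the inequality follows by optimizing over [w]. *)
Lemma circle_osc_half (a b : R) : 0 <= a -> a <= b -> b <= 2 * pi -> f1 a - f0 a <= f1 b - f0 b ->
  ((f1 b - f0 b) - (f1 a - f0 a)) ^+ 2 <= 48 * pi * \int[circle_meas]_z dl z.
Proof.
move=> a0 ab b2 uab; have p0 : 0 < pi :> R := pi_gt0 R.
have cf0 := circle_lip_continuous lf0; have cf1 := circle_lip_continuous lf1.
(* The base point lies to the left of all shifted arcs, since [0 <= a] and [w <= 2 * pi]. *)
have [P0 P0E] := cont_primitive (- (2 * pi)) cf0.
have [P1 P1E] := cont_primitive (- (2 * pi)) cf1.
set D := (f1 b - f0 b) - (f1 a - f0 a).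
have D0 : 0 <= D by rewrite subr_ge0.
(* Each function moves by at most [pi * (2 * pi)] over the arc; this keeps the shift [w] within one
   period. *)
have D4 : D <= 4 * pi ^+ 2.
  have := @lf0 a (b - a); have := @lf1 a (b - a).
  rewrite [a + _]addrC subrK subr_ge0 ab lerBlDr (le_trans b2) ?lerDl//.
  by move=> /(_ isT) /ler_normlP[h1 h2] /(_ isT) /ler_normlP[h3 h4]; rewrite /D; nra.
(* This [w] maximizes [w * D - 6 * pi * w ^+ 2]; the maximum is [D ^+ 2 / (24 * pi)], whence the
   constant [48 * pi]. *)
pose w := D / (12 * pi).
have Dw : D = 12 * pi * w by rewrite /w mulrC divfK// gt_eqF// mulr_gt0.
have w0 : 0 <= w by rewrite divr_ge0// mulr_ge0// ltW.
have w2 : w <= 2 * pi by rewrite ler_pdivrMr ?mulr_gt0//; nra.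
pose g z := 2^-1 * (f0 (z - w) - f0 z + (f1 (z + w) - f1 z) - w ^+ 2).
have shc (f : R -> R) (c : R) : continuous f -> continuous (fun z => f (z + c)).
  move=> cf z; apply: (cvg_comp (fun z : R => z + c) f); last exact: cf.
  by apply: cvgD; [exact: cvg_id|exact: cvg_cst].
have c0w := shc _ (- w) cf0; have c1w := shc _ w cf1.
have ccst (c : R) : continuous (fun _ : R => c) by move=> z; exact: cvg_cst.
have cB (h k : R -> R) : continuous h -> continuous k -> continuous (fun z => h z - k z).
  by move=> ch ck z; apply: cvgB; [exact: ch|exact: ck].
have cD (h k : R -> R) : continuous h -> continuous k -> continuous (fun z => h z + k z).
  by move=> ch ck z; apply: cvgD; [exact: ch|exact: ck].
have cG : continuous (fun z => f0 (z - w) - f0 z + (f1 (z + w) - f1 z) - w ^+ 2).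
  apply: (cB _ (fun=> w ^+ 2)); last exact: ccst.
  exact: (cD _ _ (cB _ _ c0w cf0) (cB _ _ c1w cf1)).
have cg : continuous g by move=> z; apply: cvgM; [exact: cvg_cst|exact: cG].
have dl0 z : 0 <= dl z.
  by apply: le_trans (@dlP z 0); rewrite subr0 addr0 !subrr expr0n addr0 subr0 mulr0.
have := circle_int_ge bdl dl0 cg (fun z => @dlP z w) a0 b2.
have mab : measurable (`[a, b]%classic : set (measurableTypeR R)) by exact: measurable_itv.
have ic h : continuous h -> leb.-integrable `[a, b] (EFin \o h) by exact: cont_integrable.
have -> : \int[leb]_(z in `[a, b]) g z = 2^-1 *
   (((P0 (b - w) - P0 (a - w)) - (P0 b - P0 a)) +
    ((P1 (b + w) - P1 (a + w)) - (P1 b - P1 a)) - w ^+ 2 * (b - a)).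
  rewrite RintegralZl//; last exact: ic.
  have i1 := ic _ (cB _ _ c0w cf0); have i2 := ic _ (cB _ _ c1w cf1).
  rewrite RintegralB//; last first.
  - exact: (ic _ (ccst _)).
  - exact: (ic _ (cD _ _ (cB _ _ c0w cf0) (cB _ _ c1w cf1))).
  rewrite RintegralD// RintegralB//; [|exact: (ic _ c0w)|exact: (ic _ cf0)].
  rewrite RintegralB//; [|exact: (ic _ c1w)|exact: (ic _ cf1)].
  rewrite !Rintegral_shift// !P0E ?P1E//; try lra.
  congr (_ * (_ - _)).
  by have := @Rintegral_itv_bnd (fun=> w ^+ 2) a b _ _ (ccst _) ab
    (fun _ _ => introT andP (conj (lexx _) (lexx _))) => /le_anti.
(* Over an interval of length [w] the Lipschitz bound replaces the integral by [w] times an endpoint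
   value, up to [pi * w ^+ 2]. *)
have near0 x : - (2 * pi) <= x - w -> 0 <= x ->
    w * (f0 x - pi * w) <= P0 x - P0 (x - w) <= w * (f0 x + pi * w).
  move=> xw x0; rewrite -P0E; [|by []|lra].
  have := @Rintegral_itv_bnd f0 (x - w) x (f0 x - pi * w) (f0 x + pi * w) cf0.
  rewrite opprB addrCA subrr addr0 ![_ * w]mulrC; apply; first lra.
  move=> t /andP[t1 t2]; have := @lf0 t (x - t); rewrite [t + _]addrC subrK.
  have -> : 0 <= x - t <= 2 * pi by apply/andP; split; lra.
  by move=> /(_ isT) /ler_normlP[h1 h2]; apply/andP; split; nra.
have near1 x : 0 <= x ->
    w * (f1 x - pi * w) <= P1 (x + w) - P1 x <= w * (f1 x + pi * w).
  move=> x0; rewrite -P1E; [|lra|lra].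
  have := @Rintegral_itv_bnd f1 x (x + w) (f1 x - pi * w) (f1 x + pi * w) cf1.
  rewrite [x + w - x]addrAC subrr add0r ![_ * w]mulrC; apply; first lra.
  move=> t /andP[t1 t2]; have := @lf1 x (t - x); rewrite [x + _]addrC subrK.
  have -> : 0 <= t - x <= 2 * pi by apply/andP; split; lra.
  by move=> /(_ isT) /ler_normlP[h1 h2]; apply/andP; split; nra.
have /andP[A1 A2] : w * (f0 a - pi * w) <= P0 a - P0 (a - w) <= w * (f0 a + pi * w).
  by apply: near0 => //; lra.
have /andP[B1 B2] : w * (f0 b - pi * w) <= P0 b - P0 (b - w) <= w * (f0 b + pi * w).
  by apply: near0; lra.
have /andP[C1 C2] := near1 a a0.
have /andP[E1 E2] := near1 b (le_trans a0 ab).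
have wab : w ^+ 2 * (b - a) <= w ^+ 2 * (2 * pi).
  by apply: ler_wpM2l; [exact: sqr_ge0|lra].
set I := \int[_]_z _ => HI.
(* Four endpoint estimates cost [4 * pi * w ^+ 2], and the term [w ^+ 2 * (b - a)] at most
   [2 * pi * w ^+ 2]. *)
have H : w * D - 6 * pi * w ^+ 2 <= 2 * I by rewrite /D; nra.
by rewrite Dw in H *; nra.
Qed.

End circle_osc.

(** Two symmetries remove the order assumptions: exchanging [a] and [b], and exchanging [f0] and
    [f1] while replacing [w] by [- w]. *)
Lemma circle_osc_sqr (f0 f1 dl : R -> R) (a b : R) :
  circle_lip f0 -> circle_lip f1 -> bmeas (dl : measurableTypeR R -> R) ->
  (forall z w,
     2^-1 * (f0 (z - w) - f0 z + (f1 (z + w) - f1 z) - w ^+ 2) <= dl z) ->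
  0 <= a <= 2 * pi -> 0 <= b <= 2 * pi ->
  ((f1 b - f0 b) - (f1 a - f0 a)) ^+ 2 <= 48 * pi * \int[circle_meas]_z dl z.
Proof.
move=> l0 l1 bd H.
wlog ab : a b / a <= b => [hw|] /andP[a0 a2] /andP[b0 b2].
  have [ab|ba] := leP a b; first by apply: hw => //; apply/andP.
  by rewrite -sqrrN opprB; apply: hw => //; [exact: ltW|apply/andP..].
have [u|u] := leP (f1 a - f0 a) (f1 b - f0 b); first exact: circle_osc_half.
rewrite -sqrrN opprB -[X in X ^+ 2](_ : f0 b - f1 b - (f0 a - f1 a) = _); last by ring.
apply: circle_osc_half => //; last by rewrite -lerN2 !opprB ltW.
move=> z w; apply: le_trans (H z (- w)); rewrite opprK sqrrN.
by rewrite [f0 _ - _ + _]addrC.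
Qed.

End circle_lemma.

(** * Variance on the torus *)

Section row_cons_algebra.
Context {R : realType} {d : nat}.

Let addE n (x y : 'rV[R]_n) i : (x + y) ord0 i = x ord0 i + y ord0 i.
Proof. by rewrite mxE. Qed.

Let scaleE n a (x : 'rV[R]_n) i : (a *: x) ord0 i = a * x ord0 i.
Proof. by rewrite mxE. Qed.

Lemma row_consD (s t : R) (v w : 'rV[R]_d) :
  row_cons s v + row_cons t w = row_cons (s + t) (v + w).
Proof.
apply/rowP => i; rewrite addE; case: (unliftP ord0 i) => [j|] ->.
  by rewrite !row_consS addE.
by rewrite !row_cons0.
Qed.

Lemma row_consZ (a t : R) (v : 'rV[R]_d) :
  a *: row_cons t v = row_cons (a * t) (a *: v).
Proof.
apply/rowP => i; rewrite scaleE; case: (unliftP ord0 i) => [j|] ->.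
  by rewrite !row_consS scaleE.
by rewrite !row_cons0.
Qed.

Lemma row_consB (s t : R) (v w : 'rV[R]_d) :
  row_cons s v - row_cons t w = row_cons (s - t) (v - w).
Proof. by rewrite -scaleN1r row_consZ row_consD mulN1r scaleN1r. Qed.

Lemma lattice_pt_cons (j : int) (k : 'rV[int]_d) :
  tor_lattice_pt (row_cons j k) = row_cons (2 * pi * j%:~R) (tor_lattice_pt k) :> 'rV[R]_d.+1.
Proof.
apply/rowP => i; rewrite lattice_ptE; case: (unliftP ord0 i) => [l|] ->.
  by rewrite !row_consS lattice_ptE.
by rewrite !row_cons0.
Qed.

Lemma circle_repr (t : R) : exists (j : int) (s : R),
  t = s + 2 * pi * j%:~R /\ 0 <= s <= 2 * pi.
Proof.
have [k [w [E w01]]] := cube_repr (const_mx t : 'rV[R]_1).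
exists (k ord0 ord0), (w ord0 ord0); split; last exact: w01.
have := congr1 (fun M : 'rV_1 => M ord0 ord0) E.
by rewrite mxE => ->; rewrite mxE lattice_ptE.
Qed.

End row_cons_algebra.

(** Concavity of [f x - sqnorm x / 2], written out by the identity [sqnorm_conv]. *)
Definition semiconcave {R : realType} {d : nat} (f : 'rV[R]_d -> R) : Prop :=
  forall (l : R) (a b : 'rV[R]_d), 0 <= l <= 1 ->
    (1 - l) * f a + l * f b - l * (1 - l) / 2 * sqnorm (a - b) <=
    f ((1 - l) *: a + l *: b).

(** Midpoint form of joint concavity in the function and the point: [f0] is sampled at [m - w] and
    [f1] at [m + w], and [dl] dominates the excess of their average over that of [f0 m] and [f1 m],
    less [sqnorm w / 2]. Taking [w = 0] gives [0 <= dl m]. *)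
Definition conc_gap {R : realType} {d : nat} (f0 f1 dl : 'rV[R]_d -> R) : Prop :=
  forall m w : 'rV[R]_d,
    2^-1 * (f0 (m - w) - f0 m + (f1 (m + w) - f1 m) - sqnorm w) <= dl m.

(** * Restriction to slices and coordinate lines *)

Section sections.
Context {R : realType} {d : nat}.
Implicit Types f dl : 'rV[R]_d.+1 -> R.

Lemma periodic_row_cons f (v : 'rV[R]_d) (t : R) (j : int) : tor_periodic f ->
  f (row_cons (t + 2 * pi * j%:~R) v) = f (row_cons t v).
Proof.
move=> pf; rewrite -(pf (row_cons t v) (row_cons j 0)).
by rewrite lattice_pt_cons row_consD lattice_pt0 addr0.
Qed.

Lemma periodic_section f (s : R) : tor_periodic f ->
  tor_periodic (fun v : 'rV[R]_d => f (row_cons s v)).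
Proof.
move=> pf v k; rewrite -(pf (row_cons s v) (row_cons 0 k)).
by rewrite lattice_pt_cons row_consD mulr0 addr0.
Qed.

Lemma semiconcave_section f (s : R) : semiconcave f ->
  semiconcave (fun v : 'rV[R]_d => f (row_cons s v)).
Proof.
move=> sf l a b l01; have := sf l (row_cons s a) (row_cons s b) l01.
rewrite row_consB sqnorm_cons subrr expr0n add0r !row_consZ row_consD.
by rewrite -mulrDl subrK mul1r.
Qed.

Lemma conc_gap_section f0 f1 dl (s : R) : conc_gap f0 f1 dl ->
  conc_gap (fun v : 'rV[R]_d => f0 (row_cons s v)) (fun v => f1 (row_cons s v))
    (fun v => dl (row_cons s v)).
Proof.
move=> H m w; have := H (row_cons s m) (row_cons 0 w).
by rewrite row_consB row_consD subr0 addr0 sqnorm_cons expr0n add0r.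
Qed.

Lemma conc_gap_line f0 f1 dl (v : 'rV[R]_d) : conc_gap f0 f1 dl ->
  forall z w : R,
  2^-1 * (f0 (row_cons (z - w) v) - f0 (row_cons z v)
    + (f1 (row_cons (z + w) v) - f1 (row_cons z v)) - w ^+ 2) <= dl (row_cons z v).
Proof.
move=> H z w; have := H (row_cons z v) (row_cons w 0).
by rewrite row_consB row_consD subr0 addr0 sqnorm_cons /sqnorm big1 ?addr0// => i _;
  rewrite mxE expr0n.
Qed.

(** [z + s] lies at the fraction [l = s / (2 * pi)] of the segment from [z] to [z + 2 * pi], whose
    endpoints share one value; semiconcavity bounds the drop by [2 * pi ^+ 2 * l * (1 - l)], hence
    by [pi * s]. The segment from [z + s] to [z + s + 2 * pi] gives the other sign. *)
Lemma semiconcave_circle_lip f (v : 'rV[R]_d) : tor_periodic f -> semiconcave f ->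
  circle_lip (fun t => f (row_cons t v)).
Proof.
move=> pf sf z s /andP[s0 s2]; have p0 : 0 < pi :> R := pi_gt0 R.
have key x y l : 0 <= l <= 1 -> y = x + l * (2 * pi) ->
    f (row_cons x v) - l * (1 - l) * 2 * pi ^+ 2 <= f (row_cons y v).
  move=> l01 ->; have := sf l (row_cons x v) (row_cons (x + 2 * pi) v) l01.
  rewrite row_consB !row_consZ row_consD subrr -scalerDl subrK scale1r.
  have -> : row_cons (x + 2 * pi) v = row_cons (x + 2 * pi * 1%:~R) v by rewrite mulr1.
  rewrite periodic_row_cons// sqnorm_cons [sqnorm 0]big1 => [|i _]; last first.
    by rewrite mxE expr0n.
  rewrite addr0; set F := f _; set y' := _ * x + _.
  have -> : y' = x + l * (2 * pi) by rewrite /y'; ring.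
  by apply: le_trans; rewrite le_eqVlt; apply/orP; left; apply/eqP; field.
have l01 : 0 <= s / (2 * pi) <= 1.
  have pp : 0 < 2 * pi :> R by rewrite mulr_gt0.
  by rewrite ler_pdivrMr// ler_pdivlMr// mul0r mul1r s0.
have l01' : 0 <= 1 - s / (2 * pi) <= 1.
  by have /andP[h1 h2] := l01; rewrite subr_ge0 h2 gerBl.
have sE : s / (2 * pi) * (2 * pi) = s by rewrite divfK// gt_eqF// mulr_gt0.
have k1 := key z (z + s) (s / (2 * pi)) l01; rewrite sE in k1.
have k2 := key (z + s) (z + 2 * pi * 1%:~R) (1 - s / (2 * pi)) l01'.
rewrite periodic_row_cons// mulrBl sE mul1r mulr1 in k2.
have {}k1 := k1 erefl; have {}k2 : _ <= _ := k2 ltac:(ring).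
move: k1 k2 sE l01; set l := s / _ => k1 k2 sE /andP[l0 l1].
apply/ler_normlP; split; nra.
Qed.

End sections.

(** A new coordinate costs [192 * pi ^+ 2] through its lines and doubles the cost of the remaining
    ones; the base value 1 keeps the constant positive. *)
Fixpoint poinc_cst (R : realType) (d : nat) : R :=
  if d is d'.+1 then 192 * pi ^+ 2 + 2 * poinc_cst R d' else 1.

Lemma poinc_cst_gt0 (R : realType) (d : nat) : 0 < poinc_cst R d.
Proof.
elim: d => //= d IH; rewrite addr_gt0 ?mulr_gt0 ?exprn_gt0 ?pi_gt0//.
Qed.

Lemma sqrrD_le2 (R : realDomainType) (a b : R) : (a + b) ^+ 2 <= 2 * a ^+ 2 + 2 * b ^+ 2.
Proof. by have := sqr_ge0 (a - b); nra. Qed.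

(* The hypothesis on [k] says that [k] is at most the infimum over [c]; keeping
   it in this form lets the induction apply to every slice without choosing [c]. *)
Lemma conc_gap_variance (R : realType) (d : nat) (f0 f1 dl : borelV R d -> R) :
  bmeas f0 -> bmeas f1 -> bmeas dl ->
  tor_periodic f0 -> tor_periodic f1 -> semiconcave f0 -> semiconcave f1 ->
  conc_gap f0 f1 dl ->
  forall k : R, (forall c, k <= \int[cube_meas d]_x (f1 x - f0 x - c) ^+ 2) ->
  k <= poinc_cst R d * \int[cube_meas d]_x dl x.
Proof.
elim: d f0 f1 dl => [|d IH] f0 f1 dl b0 b1 bd p0 p1 s0 s1 gap k kle.
  have int0 (g : borelV R 0 -> R) : bmeas g -> \int[cube_meas 0]_x g x = g 0.
    move=> bg; apply: EFin_inj; rewrite -bmeas_integralE//.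
    rewrite /= integral_dirac//=; last by have [/measurable_EFinP] := bg.
    by rewrite diracT mul1e.
  apply: (le_trans (kle (f1 0 - f0 0))); rewrite !int0//; last first.
    by apply: bmeas_sqr; apply: bmeasB; [exact: bmeasB|exact: bmeas_cst].
  rewrite subrr expr0n /= mul1r; apply: le_trans (gap 0 0).
  by rewrite subr0 addr0 !subrr /sqnorm big_ord0 subr0 addr0 mulr0.
have pi0 : 0 < pi :> R := pi_gt0 R.
have bS (g : borelV R d.+1 -> R) : bmeas g ->
    bmeas (fun z : measurableTypeR R * borelV R d => g (row_cons z.1 z.2)).
  exact: bmeas_comp (@measurable_row_cons R d).
have bv (g : borelV R d.+1 -> R) (t : measurableTypeR R) : bmeas g ->
    bmeas (fun v : borelV R d => g (row_cons t v)).
  by move=> bg; exact: (bmeas_pair2 t (bS _ bg)).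
have bt (g : borelV R d.+1 -> R) (v : borelV R d) : bmeas g ->
    bmeas (fun t : measurableTypeR R => g (row_cons t v)).
  by move=> bg; exact: (bmeas_pair1 v (bS _ bg)).
set E := \int[cube_meas d.+1]_x dl x.
pose De (v : borelV R d) := \int[circle_meas]_t dl (row_cons t v).
have bDe : bmeas De by exact: (bmeas_int1 circle_meas (cube_meas d) (bS _ bd)).
have EE : E = \int[cube_meas d]_v De v.
  by rewrite /E cube_meas_int_cons// (bmeas_fubini _ _ (bS _ bd)).
(* The circle estimate along the first coordinate; periodicity reduces [s] and [t] to one period. *)
have osc s t v : (f1 (row_cons t v) - f0 (row_cons t v)
    - (f1 (row_cons s v) - f0 (row_cons s v))) ^+ 2 <= 48 * pi * De v.
  have [i [s' [-> s01]]] := circle_repr s; have [j [t' [-> t01]]] := circle_repr t.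
  rewrite !periodic_row_cons//.
  apply: (@circle_osc_sqr _ (fun t => f0 (row_cons t v)) (fun t => f1 (row_cons t v))
    (fun t => dl (row_cons t v))) => //.
  - exact: semiconcave_circle_lip.
  - exact: semiconcave_circle_lip.
  - exact: bt.
  - exact: conc_gap_line.
(* Comparing every slice with the slice at [s] costs twice the squared oscillation; integrating in
   [t] over a period of length [2 * pi] gives both constants. *)
have step s c : k <= 192 * pi ^+ 2 * E + 4 * pi *
    \int[cube_meas d]_v (f1 (row_cons s v) - f0 (row_cons s v) - c) ^+ 2.
  have bu : bmeas (fun x : borelV R d.+1 => (f1 x - f0 x - c) ^+ 2).
    by apply: bmeas_sqr; apply: bmeasB; [exact: bmeasB|exact: bmeas_cst].
  apply: (le_trans (kle c)); rewrite cube_meas_int_cons//.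
  set V := (X in _ + _ * X).
  have inner t : \int[cube_meas d]_v (f1 (row_cons t v) - f0 (row_cons t v) - c) ^+ 2 <=
      96 * pi * E + 2 * V.
    rewrite EE /V -!bmeas_intZ//; last exact: (bv _ s bu).
    rewrite -bmeas_intD; [|exact: bmeasZ|exact: bmeasZ (bv _ s bu)].
    apply: bmeas_le_int.
    - exact: (bv _ t bu).
    - by apply: bmeasD; [exact: bmeasZ|exact: bmeasZ (bv _ s bu)].
    move=> v; have := osc s t v; set us := f1 (row_cons s v) - _.
    set ut := f1 (row_cons t v) - _ => h.
    have -> : ut - c = (ut - us) + (us - c) by ring.
    by apply: le_trans (sqrrD_le2 _ _) _; rewrite lerD2r; nra.
  apply: (@le_trans _ _ (\int[@circle_meas R]_t (96 * pi * E + 2 * V))).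
    apply: bmeas_le_int => //; last exact: bmeas_cst.
    exact: (bmeas_int2 circle_meas (cube_meas d) (bS _ bu)).
  by rewrite bmeas_int_cst circle_measT le_eqVlt; apply/orP; left; apply/eqP; ring.
(* The induction hypothesis on each slice, with a rescaled lower bound independent of [s];
   integrating over [s] then restores the full integral of [dl]. *)
have IHs s : (k - 192 * pi ^+ 2 * E) / (4 * pi) <=
    poinc_cst R d * \int[cube_meas d]_v dl (row_cons s v).
  apply: (IH (fun v => f0 (row_cons s v)) (fun v => f1 (row_cons s v))
    (fun v => dl (row_cons s v))).
  - exact: bv.
  - exact: bv.
  - exact: bv.
  - exact: periodic_section.
  - exact: periodic_section.
  - exact: semiconcave_section.
  - exact: semiconcave_section.
  - exact: conc_gap_section.
  by move=> c; rewrite ler_pdivrMr ?mulr_gt0// lerBlDl [_ * (4 * pi)]mulrC; exact: step.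
have bI : bmeas (fun s : measurableTypeR R => \int[cube_meas d]_v dl (row_cons s v)).
  exact: (bmeas_int2 circle_meas (cube_meas d) (bS _ bd)).
have : \int[@circle_meas R]_s ((k - 192 * pi ^+ 2 * E) / (4 * pi)) <=
    \int[circle_meas]_s (poinc_cst R d * \int[cube_meas d]_v dl (row_cons s v)).
  by apply: bmeas_le_int => //; [exact: bmeas_cst|exact: bmeasZ].
rewrite bmeas_int_cst circle_measT bmeas_intZ// -cube_meas_int_cons// -/E.
have -> : (k - 192 * pi ^+ 2 * E) / (4 * pi) * (2 * pi) = (k - 192 * pi ^+ 2 * E) / 2.
  have halve (x p : R) : p != 0 -> x / (4 * p) * (2 * p) = x / 2 by move=> ?; field.
  by rewrite halve// gt_eqF.
by rewrite ler_pdivrMr//= => h; rewrite mulrDl; lra.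
Qed.

(** * Jensen gaps of Gibbs measures *)

Section exp_quadratic.
Context {R : realType}.

Lemma expR_ge_quad (s : R) : 0 <= s -> 1 + s + s ^+ 2 / 2 <= expR s.
Proof.
move=> s0; pose h (x : R) := expR x - x ^+ 2 / 2 - x.
suff : h 0 <= h s by rewrite /h expR0 expr0n /= mul0r !subr0; lra.
have dh (x : R) : is_derive x 1 h (expR x - x - 1).
  by rewrite /h; apply: is_derive_eq; rewrite /GRing.scale/=; field.
apply: (@ger0_derive1_ndecry R h 0) => //.
- by move=> x _; rewrite derive1E (@derive_val _ _ _ _ _ _ _ (dh x)); have := expR_ge1Dx x; lra.
- apply: continuous_subspaceT => x; apply: differentiable_continuous.
  by apply/derivable1_diffP; have [] := dh x.
Qed.

(** The Pade bound [(2 - r) / (2 + r) <= expR (- r)], cleared of denominators; the derivative of [h]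
    is nonnegative because [1 + x <= expR x]. *)
Lemma expRN_ge_rat (r : R) : 0 <= r -> 2 - r <= (2 + r) * expR (- r).
Proof.
move=> r0; pose h (x : R) := (2 + x) * expR (- x) + x.
suff : h 0 <= h r by rewrite /h oppr0 expR0; lra.
have dh (x : R) : is_derive x 1 h (1 - (1 + x) * expR (- x)).
  rewrite /h; apply: is_derive_eq.
  by rewrite /GRing.scale/=; ring.
apply: (@ger0_derive1_ndecry R h 0) => //.
- move=> x _; rewrite derive1E (@derive_val _ _ _ _ _ _ _ (dh x)) subr_ge0.
  by rewrite expRN ler_pdivrMr ?expR_gt0// mul1r expR_ge1Dx.
- apply: continuous_subspaceT => x; apply: differentiable_continuous.
  by apply/derivable1_diffP; have [] := dh x.
Qed.

(** For negative [s] the left side with [b = - s] equals [(2 + s) / (2 - s)], which is the Pade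
    bound; a larger [b] only lowers it. *)
Lemma expR_ge_quad_lb (b s : R) : 0 <= b -> - b <= s ->
  1 + s + s ^+ 2 / (2 + b) <= expR s.
Proof.
move=> b0 bs; have [s0|s0] := leP 0 s.
  apply: le_trans (expR_ge_quad s0); rewrite lerD2l ler_wpM2l ?sqr_ge0//.
  by rewrite lef_pV2 ?posrE; lra.
have r0 : 0 < - s by lra.
have := expRN_ge_rat (ltW r0); rewrite opprK => h.
apply: (@le_trans _ _ (1 + s + s ^+ 2 / (2 + - s))).
  by rewrite lerD2l ler_wpM2l ?sqr_ge0// lef_pV2 ?posrE; lra.
have p : 0 < 2 + - s by lra.
rewrite -(ler_pM2l p); apply: le_trans h.
rewrite mulrDr [(2 + - s) * (_ / _)]mulrC divfK ?gt_eqF//; nra.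
Qed.

End exp_quadratic.

(** * Variance against Jensen gap for one probability density *)

Section gibbs.
Context {R : realType} {dd : measure_display} {T : measurableType dd}.
Variables (m : {finite_measure set T -> \bar R}) (q X : T -> R) (a eps : R).
Hypotheses (bq : bmeas q) (q0 : forall x, 0 <= q x) (q1 : \int[m]_x q x = 1).
Hypotheses (bX : bmeas X) (Xa : forall x y, `|X x - X y| <= a).
Hypotheses (a0 : 0 <= a) (eps0 : 0 < eps).

Let mX := \int[m]_x (X x * q x).
(** The Jensen gap of the exponential moment of [X] under the density [q]. *)
Let D := eps * ln (\int[m]_x (expR (X x / eps) * q x)) - mX.
Let V := \int[m]_x ((X x - mX) ^+ 2 * q x).
Let Y x := (X x - mX) / eps.
Let S := \int[m]_x (expR (Y x) * q x).

Let intq c : \int[m]_x (c * q x) = c.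
Proof. by rewrite bmeas_intZ// q1 mulr1. Qed.

Let bY : bmeas Y.
Proof. exact: bmeasM (bmeasB bX (bmeas_cst _)) (bmeas_cst _). Qed.

Let le_q f g : bmeas f -> bmeas g -> (forall x, f x <= g x) ->
  \int[m]_x (f x * q x) <= \int[m]_x (g x * q x).
Proof.
by move=> bf bg fg; apply: bmeas_le_int; [exact: bmeasM..|move=> x; exact: ler_wpM2r].
Qed.

Let X_mX x : `|X x - mX| <= a.
Proof.
rewrite ler_distlC; apply/andP; split.
  by rewrite -[leLHS]intq; apply: le_q => // [|y]; [exact: bmeas_cst|];
    have := Xa x y; rewrite ler_distl => /andP[]; lra.
by rewrite -[leRHS]intq; apply: le_q => // [|y]; [exact: bmeas_cst|];
  have := Xa x y; rewrite ler_distl => /andP[]; lra.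
Qed.

Let YE : \int[m]_x (Y x * q x) = 0.
Proof.
transitivity (\int[m]_x (eps^-1 * (X x * q x) - (eps^-1 * mX) * q x)).
  by apply: eq_Rintegral => x _; rewrite /Y; ring.
rewrite bmeas_intB; [|by apply: bmeasZ; exact: bmeasM|exact: bmeasZ].
by rewrite intq bmeas_intZ ?subrr//; exact: bmeasM.
Qed.

Let DE : D = eps * ln S.
Proof.
have S0 : 0 < S.
  apply: lt_le_trans (ltr01 : 0 < 1) _.
  rewrite -[leLHS](intq 1) -[X in X <= _]addr0 -YE -bmeas_intD; last 2 first.
  - exact: bmeasZ.
  - exact: bmeasM.
  apply: bmeas_le_int => [||x].
  - by apply: bmeasD; [exact: bmeasZ|exact: bmeasM].
  - by apply: bmeasM => //; exact: bmeas_expR.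
  - by rewrite -mulrDl ler_wpM2r// expR_ge1Dx.
rewrite /D (_ : \int[m]_x _ = expR (mX / eps) * S).
  rewrite lnM ?posrE ?expR_gt0// expRK mulrDr [eps * (_ / _)]mulrC divfK ?gt_eqF//.
  by rewrite addrAC subrr add0r.
rewrite /S -bmeas_intZ; last by apply: bmeasM => //; exact: bmeas_expR.
apply: eq_Rintegral => x _; rewrite mulrA -expRD /Y -mulrDl.
by rewrite [mX + _]addrC subrK.
Qed.

(** Integrate [expR_ge_quad_lb] at [Y]: the linear term has mean zero, and [Y] is at least
    [- (a / eps)]. *)
Let S_ge : 1 + V / eps ^+ 2 / (2 + a / eps) <= S.
Proof.
have b0 : 0 <= a / eps by rewrite divr_ge0// ltW.
have bV : bmeas (fun x => (X x - mX) ^+ 2 * q x).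
  by apply: bmeasM => //; apply: bmeas_sqr; apply: bmeasB => //; exact: bmeas_cst.
have -> : 1 + V / eps ^+ 2 / (2 + a / eps) =
    \int[m]_x (1 * q x + Y x * q x
      + (eps ^+ 2)^-1 / (2 + a / eps) * ((X x - mX) ^+ 2 * q x)).
  rewrite bmeas_intD; [|by apply: bmeasD; [exact: bmeasZ|exact: bmeasM]|exact: bmeasZ].
  rewrite bmeas_intD; [|exact: bmeasZ|exact: bmeasM].
  by rewrite intq YE addr0 bmeas_intZ// -/V; congr (1 + _); ring.
apply: bmeas_le_int => [||x].
- by apply: bmeasD; [apply: bmeasD; [exact: bmeasZ|exact: bmeasM]|exact: bmeasZ].
- by apply: bmeasM => //; exact: bmeas_expR.
rewrite (_ : 1 * q x + _ + _ = (1 + Y x + Y x ^+ 2 / (2 + a / eps)) * q x); last first.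
  by rewrite /Y expr_div_n; ring.
apply: ler_wpM2r => //; apply: expR_ge_quad_lb => //.
rewrite /Y -mulNr ler_pM2r ?invr_gt0//.
by have := X_mX x; rewrite ler_norml => /andP[].
Qed.

Let V_ge0 : 0 <= V.
Proof. by apply: Rintegral_ge0 => x _; rewrite mulr_ge0 ?sqr_ge0. Qed.

Let V_le : V <= a ^+ 2.
Proof.
rewrite -(intq (a ^+ 2)); apply: le_q.
- by apply: bmeas_sqr; apply: bmeasB => //; exact: bmeas_cst.
- exact: bmeas_cst.
- by move=> x; rewrite -real_normK ?num_real// ler_sqr ?nnegrE ?X_mX.
Qed.

Let S_ge1 : 1 <= S.
Proof.
apply: le_trans S_ge; rewrite lerDl !mulr_ge0 ?invr_ge0 ?sqr_ge0//.
by rewrite addr_ge0// divr_ge0// ltW.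
Qed.

Lemma gibbs_gap_ge0 : 0 <= D.
Proof. by rewrite DE mulr_ge0 ?(ltW eps0)// ln_ge0. Qed.

Lemma gibbs_gap_le : D <= a.
Proof.
rewrite DE -ler_pdivlMl// -ler_expR lnK ?posrE ?(lt_le_trans ltr01)// mulrC.
rewrite -[leRHS]intq; apply: le_q; [exact: bmeas_expR|exact: bmeas_cst|].
move=> x; rewrite ler_expR /Y ler_pM2r ?invr_gt0//.
exact: le_trans (ler_norm _) (X_mX x).
Qed.

(** With [b = a / eps] and [V = eps ^+ 2 * (2 + b) * v], the bounds [1 + v <= S] and
    [1 - S^-1 <= ln S] give [eps * (v / (1 + v)) <= D]; then [V <= a ^+ 2] controls the factor
    [1 + v]. *)
Lemma gibbs_variance_le : V <= (2 * eps + a + a ^+ 2 / eps) * D.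
Proof.
have b0 : 0 <= a / eps by rewrite divr_ge0// ltW.
have S0 : 0 < S by exact: lt_le_trans ltr01 S_ge1.
have lnS : 1 - S^-1 <= ln S.
  by have := expR_ge1Dx (- ln S); rewrite expRN lnK ?posrE//; lra.
have aE : a = a / eps * eps by rewrite divfK// gt_eqF.
move: b0 aE S_ge; set b := a / eps => b0 aE.
set v := V / eps ^+ 2 / (2 + b) => Sv.
have v0 : 0 <= v by rewrite !mulr_ge0 ?invr_ge0 ?sqr_ge0// addr_ge0.
have vE : V = eps ^+ 2 * (2 + b) * v.
  have cancel (x e c : R) : 0 < e -> 0 < c -> x = e ^+ 2 * c * (x / e ^+ 2 / c).
    by move=> e0 c0; field; rewrite !gt_eqF.
  by apply: cancel => //; lra.
have hS : v / (1 + v) <= ln S.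
  apply: le_trans lnS; rewrite (_ : v / (1 + v) = 1 - (1 + v)^-1); last first.
    by field; rewrite gt_eqF//; lra.
  by rewrite lerD2l lerN2 lef_pV2 ?posrE//; lra.
have key : (2 + b) * (1 + v) <= 2 + b + b ^+ 2.
  suff : (2 + b) * v <= b ^+ 2 by lra.
  rewrite -(ler_pM2l (exprn_gt0 2 eps0)) mulrA -vE -exprMn [eps * b]mulrC -aE.
  exact: V_le.
rewrite DE (_ : _ + _ = eps * (2 + b + b ^+ 2)); last first.
  by rewrite aE; field; rewrite gt_eqF.
rewrite vE; apply: (@le_trans _ _ (eps * (2 + b + b ^+ 2) * (eps * (v / (1 + v))))).
  have -> : eps * (2 + b + b ^+ 2) * (eps * (v / (1 + v))) =
    eps ^+ 2 * ((2 + b + b ^+ 2) / (1 + v)) * v by ring.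
  rewrite ler_wpM2r// ler_wpM2l ?sqr_ge0// ler_pdivlMr//; lra.
rewrite ler_wpM2l// ?ler_pM2l//.
by rewrite mulr_ge0 ?(ltW eps0)// !addr_ge0// sqr_ge0.
Qed.

End gibbs.

(** * The soft transform *)

Section torus_functions.
Context {R : realType} {d : nat}.
Implicit Types f : 'rV[R]_d -> R.

Lemma periodic_continuous_bounded f : tor_periodic f -> continuous f ->
  exists M, forall x, `|f x| <= M.
Proof.
move=> pf cf; pose Q := [set v : 'rV[R]_d | forall i, `[0, 2 * pi]%classic (v ord0 i)].
have cQ : compact Q.
  by apply: (@rV_compact R d (fun=> `[0, 2 * pi]%classic)) => i; exact: segment_compact.
have /compact_bounded[M [_ HM]] : compact (f @` Q).
  by apply: continuous_compact => //; exact: continuous_subspaceT.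
exists (M + 1) => z; have [k [w [-> w01]]] := cube_repr z; rewrite pf.
apply: (HM (M + 1)); first by rewrite ltrDl.
by exists w => // i; rewrite /= in_itv/=; exact: w01.
Qed.

Lemma periodic_continuous_bmeas f : tor_periodic f -> continuous f ->
  bmeas (f : borelV R d -> R).
Proof.
move=> pf cf; split; first exact: continuous_borelV.
exact: periodic_continuous_bounded.
Qed.

Lemma tor_osc_le f x y : tor_periodic f -> continuous f -> `|f x - f y| <= tor_osc f.
Proof.
move=> pf cf; have [M fM] := periodic_continuous_bounded pf cf.
have ub : has_ubound (range f).
  by exists M => _ [z _ <-]; exact: le_trans (ler_norm _) (fM z).
have lb : has_lbound (range f).
  by exists (- M) => _ [z _ <-]; have := fM z; rewrite ler_norml => /andP[].
have s z : f z <= sup (range f) by apply: (ub_le_sup ub); exists z.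
have i z : inf (range f) <= f z by apply: (ge_inf lb); exists z.
rewrite /tor_osc ler_norml; have := s x; have := s y; have := i x; have := i y.
by move=> *; apply/andP; split; lra.
Qed.

Lemma tor_costC (eps : R) (x y : 'rV[R]_d) : tor_cost eps x y = tor_cost eps y x.
Proof. by rewrite /tor_cost -opprB heat_kernelN. Qed.

(** The cost is symmetric, so both transforms are one operator applied to different densities; the
    second inequality becomes the first with the roles exchanged. *)
Lemma tor_cT_nuE (nu psi : 'rV[R]_d -> R) (eps : R) :
  tor_cT_nu nu eps psi = tor_cT_mu nu eps psi.
Proof.
apply/funext => x; rewrite /tor_cT_nu /tor_cT_mu.
have -> : tor_cost eps x = (fun y : 'rV[R]_d => tor_cost eps y x).
  by apply/funext => y; exact: tor_costC.
reflexivity.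
Qed.

End torus_functions.

Lemma cT_arith {R : realType} (eps l s u v w : R) : 0 < eps ->
  w <= (1 - l) * u + l * v + l * (1 - l) * s / (2 * eps) ->
  (1 - l) * (- eps * u) + l * (- eps * v) - l * (1 - l) / 2 * s <= - eps * w.
Proof.
move=> eps0; rewrite -(ler_pM2l eps0) mulrDr.
have -> : eps * (l * (1 - l) * s / (2 * eps)) = l * (1 - l) / 2 * s.
  by field; rewrite gt_eqF.
by lra.
Qed.

(** Young's inequality for the integrands after division by the partition functions [z0] and [z1];
    the hypothesis on [ln k] is supplied by the log-semiconvexity of the kernel. *)
Lemma gibbs_weight_conv {R : realType} (l c e u v k k0 k1 z0 z1 w E : R) :
  0 <= l <= 1 -> 0 < k -> 0 < k0 -> 0 < k1 -> 0 < z0 -> 0 < z1 -> 0 <= w ->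
  ln k <= (1 - l) * ln k0 + l * ln k1 + c ->
  E = expR ((1 - l) * ln z0 + l * ln z1 + c) ->
  expR (((1 - l) * u + l * v) / e) * k * w <=
  E * (1 - l) / z0 * (expR (u / e) * k0 * w) + E * l / z1 * (expR (v / e) * k1 * w).
Proof.
move=> l01 kp k0p k1p z0p z1p w0 hk EE.
have -> : E * (1 - l) / z0 * (expR (u / e) * k0 * w) + E * l / z1 * (expR (v / e) * k1 * w)
  = E * ((1 - l) * (expR (u / e) * k0 / z0) + l * (expR (v / e) * k1 / z1)) * w by ring.
rewrite ler_wpM2r// -{1}(lnK kp) -expRD.
have -> : expR (u / e) * k0 / z0 = expR (u / e + ln k0 - ln z0).
  by rewrite expRB expRD !lnK.
have -> : expR (v / e) * k1 / z1 = expR (v / e + ln k1 - ln z1).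
  by rewrite expRB expRD !lnK.
apply: (@le_trans _ _ (E * expR ((1 - l) * (u / e + ln k0 - ln z0) +
    l * (v / e + ln k1 - ln z1)))); last by rewrite EE ler_pM2l ?expR_gt0// expR_conv.
by rewrite EE -expRD ler_expR; move: (e^-1) => ie; lra.
Qed.

(** * Regularity and joint concavity of the soft transform *)

Section ctransform.
Context {R : realType} {d : nat}.
Variables (mu : borelV R d -> R) (m eps : R).
Hypotheses (bmu : bmeas mu) (m0 : 0 < m) (mmu : forall x, m <= mu x).
Hypotheses (mu1 : \int[cube_meas d]_x mu x = 1) (eps0 : 0 < eps).
Implicit Types f : borelV R d -> R.
Local Notation K := (@tor_heat_kernel R d eps).

(** The integrand of the soft transform at the point [z.2], with the exponential of the cost
    resolved into the heat kernel; it is a function of the pair so that Fubini applies. *)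
Definition gibbs_weight f (z : borelV R d * borelV R d) : R :=
  expR (f z.1 / eps) * K (z.1 - z.2 : 'rV[R]_d) * mu z.1.

Definition partition_fun f (y : borelV R d) : R :=
  \int[cube_meas d]_x gibbs_weight f (x, y).

Lemma bmeas_kernel : bmeas (fun z : borelV R d * borelV R d => K (z.1 - z.2 : 'rV[R]_d)).
Proof.
split; first exact: measurable_heat_kernel.
have [M KM] := @heat_kernel_ub R d eps eps0.
by exists M => z; rewrite ger0_norm// ltW// heat_kernel_gt0.
Qed.

Lemma bmeas_gibbs_weight f : bmeas f -> bmeas (gibbs_weight f).
Proof.
move=> bf; apply: bmeasM; last exact: bmeas_comp measurable_fst bmu.
apply: bmeasM bmeas_kernel.
apply: (@bmeas_comp _ _ _ _ _ fst (fun x => expR (f x / eps))); first exact: measurable_fst.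
by apply: bmeas_expR; apply: bmeasM => //; exact: bmeas_cst.
Qed.

Let mu_gt0 x : 0 < mu x. Proof. exact: lt_le_trans (mmu x). Qed.

Lemma gibbs_weight_gt0 f z : 0 < gibbs_weight f z.
Proof. 
apply: mulr_gt0 (mu_gt0 _); apply: mulr_gt0; first exact: expR_gt0.
exact: heat_kernel_gt0.
Qed.

Lemma bmeas_partition f : bmeas f -> bmeas (partition_fun f).
Proof. by move=> bf; exact: (bmeas_int1 _ (cube_meas d) (bmeas_gibbs_weight bf)). Qed.

(** A positive bound uniform in [y] keeps both the logarithm and the inverse of the partition
    function bounded. *)
Lemma partition_lb f : bmeas f -> exists2 z0, 0 < z0 & forall y, z0 <= partition_fun f y.
Proof.
move=> bf; have [_ [M fM]] := bf; have [k k0 kK] := @heat_kernel_lb R d eps eps0.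
exists (expR (- M / eps) * k); first by rewrite mulr_gt0 ?expR_gt0.
move=> y; rewrite -[leLHS]mulr1 -mu1 -bmeas_intZ//; apply: bmeas_le_int.
- exact: bmeasZ.
- exact: bmeas_pair1 (bmeas_gibbs_weight bf).
move=> x; rewrite /gibbs_weight ler_wpM2r ?(ltW (mu_gt0 x))//.
rewrite ler_pM ?expR_ge0 ?(ltW k0)// ler_expR ler_pM2r ?invr_gt0//.
by have := fM x; rewrite ler_norml => /andP[].
Qed.

Lemma partition_gt0 f y : bmeas f -> 0 < partition_fun f y.
Proof. by move=> /partition_lb[z z0 zP]; exact: lt_le_trans (zP y). Qed.

Lemma tor_cT_muE f y : bmeas f -> tor_cT_mu mu eps f y = - eps * ln (partition_fun f y).
Proof.
move=> bf; rewrite /tor_cT_mu.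
rewrite (_ : (fun x => _) = (fun x => gibbs_weight f (x, y))).
  by rewrite tor_tintE//; exact: bmeas_pair1 (bmeas_gibbs_weight bf).
apply/funext => x; rewrite /gibbs_weight /tor_cost /=; congr (_ * _).
have -> : (f x - - eps * ln (K (x - y))) / eps = f x / eps + ln (K (x - y)).
  by rewrite mulNr opprK mulrDl [eps * _]mulrC mulfK// gt_eqF.
by rewrite expRD lnK// posrE heat_kernel_gt0.
Qed.

Lemma bmeas_cT f : bmeas f -> bmeas (tor_cT_mu mu eps f : borelV R d -> R).
Proof.
move=> bf; have [z z0 zP] := partition_lb bf.
apply: (@eq_bmeas _ _ _ (fun y => - eps * ln (partition_fun f y))).
  by move=> y; rewrite tor_cT_muE.
by apply: bmeasZ; apply: bmeas_ln z0 zP _; exact: bmeas_partition.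
Qed.

Lemma periodic_cT f : bmeas f -> tor_periodic (tor_cT_mu mu eps f).
Proof.
move=> bf y k; rewrite (tor_cT_muE (y + _) bf) (tor_cT_muE y bf).
suff -> : partition_fun f (y + tor_lattice_pt k) = partition_fun f y by [].
apply: eq_Rintegral => x _; rewrite /gibbs_weight /=.
have -> : x - (y + tor_lattice_pt k) = (x - y) + tor_lattice_pt (- k) :> 'rV[R]_d.
  by rewrite opprD addrA -lattice_ptN.
by rewrite heat_kernel_periodic.
Qed.

(** Presents the partition function at a fixed point as an anonymous positive real, which keeps the
    terms small. *)
Lemma cT_partition f y : bmeas f -> exists Z, [/\ 0 < Z,
  tor_cT_mu mu eps f y = - eps * ln Z,
  bmeas (fun x => gibbs_weight f (x, y)) &
  \int[cube_meas d]_x gibbs_weight f (x, y) = Z].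
Proof.
move=> bf; exists (partition_fun f y); split.
- exact: partition_gt0.
- exact: tor_cT_muE.
- exact: bmeas_pair1 (bmeas_gibbs_weight bf).
- by [].
Qed.

(** Hoelder's inequality once more, now for the integral against [mu]: the kernel contributes the
    quadratic correction through [heat_kernel_log_semiconvex], and the exponentials of [f0] and [f1]
    interpolate exactly. *)
Lemma cT_joint_semiconcave f0 f1 (l : R) (y0 y1 : 'rV[R]_d) :
  bmeas f0 -> bmeas f1 -> 0 <= l <= 1 ->
  (1 - l) * tor_cT_mu mu eps f0 y0 + l * tor_cT_mu mu eps f1 y1
    - l * (1 - l) / 2 * sqnorm (y0 - y1) <=
  tor_cT_mu mu eps (fun x => (1 - l) * f0 x + l * f1 x) ((1 - l) *: y0 + l *: y1).
Proof.
move=> b0 b1 l01.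
have bl : bmeas (fun x => (1 - l) * f0 x + l * f1 x) by apply: bmeasD; exact: bmeasZ.
have [Z0 [Z0p -> bw0 I0]] := cT_partition y0 b0.
have [Z1 [Z1p -> bw1 I1]] := cT_partition y1 b1.
have [Zl [Zlp -> bwl Il]] := cT_partition ((1 - l) *: y0 + l *: y1) bl.
apply: cT_arith => //; rewrite -ler_expR lnK ?posrE// -Il; set E := expR _.
(* The two partition functions normalize the weights, so the summands integrate to [E * (1 - l)] and
   [E * l]. *)
have -> : E = \int[cube_meas d]_x (E * (1 - l) / Z0 * gibbs_weight f0 (x, y0)
    + E * l / Z1 * gibbs_weight f1 (x, y1)).
  rewrite bmeas_intD; [|exact: bmeasZ|exact: bmeasZ].
  have J0 (c : R) : \int[cube_meas d]_x (c * gibbs_weight f0 (x, y0)) = c * Z0.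
    by rewrite -I0; exact: bmeas_intZ.
  have J1 (c : R) : \int[cube_meas d]_x (c * gibbs_weight f1 (x, y1)) = c * Z1.
    by rewrite -I1; exact: bmeas_intZ.
  have Z0n : Z0 != 0 by rewrite gt_eqF.
  have Z1n : Z1 != 0 by rewrite gt_eqF.
  transitivity (E * (1 - l) / Z0 * Z0 + E * l / Z1 * Z1).
    by rewrite (divfK Z0n) (divfK Z1n) -mulrDr subrK mulr1.
  exact: (esym (congr2 +%R (J0 (E * (1 - l) / Z0)) (J1 (E * l / Z1)))).
apply: bmeas_le_int; [exact: bwl|by apply: bmeasD; exact: bmeasZ|move=> x].
apply: gibbs_weight_conv => //; try exact: heat_kernel_gt0.
  exact/ltW/mu_gt0.
have := @heat_kernel_log_semiconvex R d eps eps0 l (x - y0) (x - y1) l01.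
have -> : (1 - l) *: (x - y0) + l *: (x - y1) = x - ((1 - l) *: y0 + l *: y1) :> 'rV[R]_d.
  by rewrite !scalerBr addrACA -scalerDl subrK scale1r -opprD.
have -> : x - y0 - (x - y1) = - (y0 - y1) :> 'rV[R]_d.
  by rewrite opprB addrC addrA subrK opprB.
by rewrite sqnormN.
Qed.

Lemma semiconcave_cT f : bmeas f -> semiconcave (tor_cT_mu mu eps f).
Proof.
move=> bf l a b l01; have := cT_joint_semiconcave a b bf bf l01.
have -> // : (fun x => (1 - l) * f x + l * f x) = f.
by apply/funext => x; rewrite -mulrDl subrK mul1r.
Qed.

End ctransform.

(** Bias-variance decomposition around the point [- c]. *)
Lemma second_moment_shift {R : realType} {dd : measure_display} {T : measurableType dd}
    (m : {finite_measure set T -> \bar R}) (q X : T -> R) (c : R) :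
  bmeas q -> bmeas X -> \int[m]_x q x = 1 ->
  \int[m]_x ((X x + c) ^+ 2 * q x) =
  \int[m]_x ((X x - \int[m]_x (X x * q x)) ^+ 2 * q x) + (\int[m]_x (X x * q x) + c) ^+ 2.
Proof.
move=> bq bX q1; set p := \int[m]_x (X x * q x).
have bXq : bmeas (fun x => X x * q x) by exact: bmeasM.
have bV : bmeas (fun x => (X x - p) ^+ 2 * q x).
  by apply: bmeasM => //; apply: bmeas_sqr; apply: bmeasB => //; exact: bmeas_cst.
transitivity (\int[m]_x ((X x - p) ^+ 2 * q x
    + (2 * (p + c) * (X x * q x) + (c ^+ 2 - p ^+ 2) * q x))).
  by apply: eq_Rintegral => x _; ring.
rewrite bmeas_intD//; last by apply: bmeasD; exact: bmeasZ.
rewrite bmeas_intD; [|exact: bmeasZ|exact: bmeasZ].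
by rewrite !bmeas_intZ// q1 -/p; congr (_ + _); ring.
Qed.

(** * Variance of a mixture of conditional laws *)

Section gibbs_mixture.
Context {R : realType} {dd : measure_display} {T : measurableType dd}.
Variables (m : {finite_measure set T -> \bar R}) (q : T * T -> R) (mu nu X u : T -> R).
Variables (a eps : R).
Hypotheses (bq : bmeas q) (q0 : forall z, 0 <= q z).
Hypothesis q1 : forall y, \int[m]_x q (x, y) = 1.
Hypothesis qmu : forall x, \int[m]_y (q (x, y) * nu y) = mu x.
Hypotheses (bnu : bmeas nu) (nu0 : forall y, 0 <= nu y).
Hypotheses (bmu : bmeas mu) (mu1 : \int[m]_x mu x = 1).
Hypotheses (bX : bmeas X) (Xa : forall x y, `|X x - X y| <= a).
Hypotheses (a0 : 0 <= a) (eps0 : 0 < eps) (bu : bmeas u).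
Hypothesis uE : forall y, u y = - (eps * ln (\int[m]_x (expR (X x / eps) * q (x, y)))).

Let P (f : T -> R) y := \int[m]_x (f x * q (x, y)).

Let bfq (f : T -> R) : bmeas f -> bmeas (fun z : T * T => f z.1 * q z).
Proof. by move=> bf; apply: bmeasM => //; exact: bmeas_comp measurable_fst bf. Qed.

Let bP f : bmeas f -> bmeas (P f).
Proof. by move=> bf; exact: (bmeas_int1 m m (bfq bf)). Qed.

(** Law of total expectation for the mixture: Fubini, then the marginal identity [qmu]. *)
Let exch f : bmeas f -> \int[m]_y (P f y * nu y) = \int[m]_x (f x * mu x).
Proof.
move=> bf.
have bF : bmeas (fun z : T * T => f z.1 * q z * nu z.2).
  by apply: bmeasM (bfq bf) _; exact: bmeas_comp measurable_snd bnu.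
transitivity (\int[m]_y \int[m]_x (f x * q (x, y) * nu y)).
  apply: eq_Rintegral => y _; rewrite /P mulrC -bmeas_intZ; last first.
    exact: (bmeas_pair1 y (bfq bf)).
  by apply: eq_Rintegral => x _; rewrite mulrC.
rewrite -(bmeas_fubini m m bF) /=; apply: eq_Rintegral => x _.
rewrite -qmu -bmeas_intZ; last by apply: bmeasM => //; exact: bmeas_pair2.
by apply: eq_Rintegral => y _; rewrite mulrA.
Qed.

Let D y := - u y - P X y.

Let bD : bmeas D.
Proof.
apply: bmeasB; last exact: bP.
by apply: eq_bmeas (bmeasZ (-1) bu) => y; rewrite mulN1r.
Qed.

Let DE : \int[m]_y (D y * nu y) = - (\int[m]_y (u y * nu y)) - \int[m]_x (X x * mu x).
Proof.
rewrite -exch//; transitivity (\int[m]_y (-1 * (u y * nu y) - P X y * nu y)).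
  by apply: eq_Rintegral => y _; rewrite /D; ring.
have bun : bmeas (fun y => u y * nu y) by exact: bmeasM.
have bPn : bmeas (fun y => P X y * nu y) by apply: bmeasM => //; exact: bP.
rewrite bmeas_intB; [|exact: bmeasZ|exact: bPn].
by rewrite (bmeas_intZ _ _ bun) mulN1r.
Qed.

(** The conditional variance at [y] is at most [2 * eps + a + a ^+ 2 / eps] times [D y]. The
    conditional mean is [- u y - D y], so its squared distance to [- c] is at most
    [2 * (u y - c) ^+ 2 + 2 * D y ^+ 2], and [D y <= a] turns the last term into [2 * a * D y]. *)
Lemma gibbs_mixture_variance (c : R) :
  \int[m]_x ((X x - \int[m]_x (X x * mu x)) ^+ 2 * mu x) <=
  (2 * eps + 3 * a + a ^+ 2 / eps)
    * (- (\int[m]_y (u y * nu y)) - \int[m]_x (X x * mu x))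
  + 2 * \int[m]_y ((u y - c) ^+ 2 * nu y).
Proof.
have bXc : bmeas (fun x => (X x + c) ^+ 2).
  by apply: bmeas_sqr; apply: bmeasD => //; exact: bmeas_cst.
have bDn : bmeas (fun y => D y * nu y) by exact: bmeasM.
have buc : bmeas (fun y => (u y - c) ^+ 2 * nu y).
  by apply: bmeasM => //; apply: bmeas_sqr; apply: bmeasB => //; exact: bmeas_cst.
apply: (@le_trans _ _ (\int[m]_x ((X x + c) ^+ 2 * mu x))).
  by rewrite [leRHS](second_moment_shift c bmu bX mu1) lerDl sqr_ge0.
rewrite -DE -(exch bXc) -!bmeas_intZ// -bmeas_intD; [|exact: bmeasZ|exact: bmeasZ].
apply: bmeas_le_int; first by apply: bmeasM => //; exact: bP.
  by apply: bmeasD; exact: bmeasZ.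
move=> y; rewrite [_ * (D y * nu y)]mulrA [2 * (_ * nu y)]mulrA -mulrDl; apply: ler_wpM2r => //.
have bqy : bmeas (fun x => q (x, y)) by exact: bmeas_pair1.
rewrite /P (second_moment_shift c bqy bX (q1 y)).
have DyE : D y = eps * ln (\int[m]_x (expR (X x / eps) * q (x, y)))
    - \int[m]_x (X x * q (x, y)).
  by rewrite /D uE opprK.
have D0 := gibbs_gap_ge0 bqy (fun x => q0 (x, y)) (q1 y) bX Xa a0 eps0.
have Da := gibbs_gap_le bqy (fun x => q0 (x, y)) (q1 y) bX Xa a0 eps0.
have DV := gibbs_variance_le bqy (fun x => q0 (x, y)) (q1 y) bX Xa a0 eps0.
rewrite -DyE in D0 Da DV.
have pE : \int[m]_x (X x * q (x, y)) = - u y - D y by rewrite /D /P; ring.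
move: DV; rewrite pE; set V := \int[m]_x _ => DV.
have -> : - u y - D y + c = - ((u y - c) + D y) by ring.
rewrite sqrrN; have h := sqrrD_le2 (u y - c) (D y).
have h2 : D y ^+ 2 <= a * D y by rewrite expr2 ler_wpM2r.
by move: DV h h2; set K := a ^+ 2 / eps => *; nra.
Qed.

End gibbs_mixture.

(** * The Schroedinger plan *)

Lemma conc_gap_ge0 {R : realType} {d : nat} (f0 f1 dl : 'rV[R]_d -> R) :
  conc_gap f0 f1 dl -> forall y, 0 <= dl y.
Proof.
move=> H y; apply: le_trans (H y 0).
have -> : sqnorm (0 : 'rV[R]_d) = 0 by apply: big1 => i _; rewrite mxE expr0n.
by rewrite !subr0 !addr0 !subrr addr0 mulr0.
Qed.

(** The upper bound on [nu] passes from the weighted variance to Lebesgue measure, where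
    [conc_gap_variance] applies; the lower bound returns to the weighted integral of [dl]. Hence the
    ratio [M / m]. *)
Lemma weighted_conc_gap_variance {R : realType} {d : nat} (g0 g1 dl nu : borelV R d -> R)
    (m M V K G : R) :
  bmeas g0 -> bmeas g1 -> bmeas dl -> bmeas nu ->
  tor_periodic g0 -> tor_periodic g1 -> semiconcave g0 -> semiconcave g1 ->
  conc_gap g0 g1 dl -> 0 < m -> 0 < M -> (forall y, m <= nu y <= M) ->
  (forall c, V <= K * G + 2 * \int[cube_meas d]_y ((g1 y - g0 y - c) ^+ 2 * nu y)) ->
  \int[cube_meas d]_y (dl y * nu y) <= G / 2 ->
  V <= (K + M / m * poinc_cst R d) * G.
Proof.
move=> b0 b1 bd bn p0 p1 s0 s1 gap m0 M0 nuP HV Hd.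
have C0 := poinc_cst_gt0 R d.
have dl0 := conc_gap_ge0 gap.
(* The left side lies below every centred second moment by [HV], so it can serve as the constant [k]
   of [conc_gap_variance]. *)
have h1 : (V - K * G) / (2 * M) <= poinc_cst R d * \int[cube_meas d]_x dl x.
  apply: (conc_gap_variance b0 b1 bd p0 p1 s0 s1 gap) => c.
  have bs : bmeas (fun y => (g1 y - g0 y - c) ^+ 2).
    by apply: bmeas_sqr; apply: bmeasB; [exact: bmeasB|exact: bmeas_cst].
  rewrite ler_pdivrMr ?mulr_gt0// lerBlDl; apply: (le_trans (HV c)); rewrite lerD2l.
  rewrite [leRHS]mulrC -mulrA ler_pM2l// -(bmeas_intZ _ _ bs).
  apply: bmeas_le_int; [exact: bmeasM|exact: bmeasZ|move=> y].
  by rewrite [leRHS]mulrC ler_wpM2l ?sqr_ge0//; have /andP[] := nuP y.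
have h2 : m * \int[cube_meas d]_x dl x <= G / 2.
  apply: le_trans Hd; rewrite -(bmeas_intZ _ _ bd).
  apply: bmeas_le_int; [exact: bmeasZ|exact: bmeasM|move=> y].
  by rewrite mulrC ler_wpM2l//; have /andP[] := nuP y.
move: h1 h2; set I := \int[_]_x _ => h1 h2.
have h3 : I <= G / 2 / m by rewrite ler_pdivlMr// mulrC.
have h4 : (V - K * G) / (2 * M) <= poinc_cst R d * (G / 2 / m).
  by apply: (le_trans h1); rewrite ler_wpM2l// ltW.
move: h4; rewrite ler_pdivrMr ?mulr_gt0// lerBlDl => h4; apply: (le_trans h4).
by rewrite le_eqVlt; apply/orP; left; apply/eqP; move: (m^-1) => im; field.
Qed.

(** * Functionals of the statement as integrals against [cube_meas] *)

Section density.
Context {R : realType} {d : nat}.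
Variables (mu : 'rV[R]_d -> R) (m M : R).
Hypotheses (m0 : 0 < m) (dmu : tor_bounded_density mu m M).

Lemma density_bmeas : bmeas (mu : borelV R d -> R).
Proof.
have [_ /tor_borel_measP mmu mM _] := dmu; split => //.
exists M => x; have /andP[h1 h2] := mM x.
by rewrite ger0_norm// ltW// (lt_le_trans m0).
Qed.

Lemma density_int1 : \int[cube_meas d]_x (mu : borelV R d -> R) x = 1.
Proof. by have [_ _ _ <-] := dmu; rewrite (tor_tintE density_bmeas). Qed.

End density.

Lemma tor_IfunE {R : realType} {d : nat} (mu nu f : borelV R d -> R) (eps : R) :
  bmeas mu -> bmeas nu -> bmeas f -> bmeas (tor_cT_mu mu eps f : borelV R d -> R) ->
  tor_Ifun mu nu eps f = \int[cube_meas d]_x (f x * mu x)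
    + \int[cube_meas d]_y (tor_cT_mu mu eps f y * nu y).
Proof.
move=> bmu bnu bf bT; rewrite /tor_Ifun (tor_tintE (bmeasM bf bmu)).
by rewrite (tor_tintE (bmeasM bT bnu)).
Qed.

Lemma tor_varianceE {R : realType} {d : nat} (mu f : borelV R d -> R) :
  bmeas mu -> bmeas f ->
  tor_variance mu f =
  \int[cube_meas d]_x ((f x - \int[cube_meas d]_x (f x * mu x)) ^+ 2 * mu x).
Proof.
move=> bmu bf; rewrite /tor_variance (tor_tintE (bmeasM bf bmu)).
have bV : bmeas (fun x => (f x - \int[cube_meas d]_x (f x * mu x)) ^+ 2 * mu x).
  by apply: bmeasM => //; apply: bmeas_sqr; apply: bmeasB => //; exact: bmeas_cst.
by rewrite (tor_tintE bV).
Qed.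

Section schrodinger.
Context {R : realType} {d : nat}.
Variables (mu nu : borelV R d -> R) (m_mu m_nu eps : R).
Hypotheses (bmu : bmeas mu) (mmu0 : 0 < m_mu) (mmu : forall x, m_mu <= mu x).
Hypotheses (bnu : bmeas nu) (mnu0 : 0 < m_nu) (mnu : forall x, m_nu <= nu x).
Hypotheses (mu1 : \int[cube_meas d]_x mu x = 1) (nu1 : \int[cube_meas d]_x nu x = 1).
Hypothesis eps0 : 0 < eps.
Variables phi psi : borelV R d -> R.
Hypotheses (bphi : bmeas phi) (bpsi : bmeas psi).
Hypotheses (phiE : phi = tor_cT_mu nu eps psi) (psiE : psi = tor_cT_mu mu eps phi).

Let Z := partition_fun mu eps phi.

(** For fixed [z.2], the density in [z.1] of the conditional law with respect to Lebesgue measure: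
    the factor [mu] is included, [nu] is not. *)
Definition schrodinger_plan (z : borelV R d * borelV R d) : R :=
  gibbs_weight mu eps phi z * (Z z.2)^-1.

Lemma bmeas_schrodinger_plan : bmeas schrodinger_plan.
Proof.
have [z0 z0p zP] := partition_lb bmu mmu0 mmu mu1 eps0 bphi.
apply: bmeasM; first exact: bmeas_gibbs_weight.
apply: (@bmeas_comp _ _ _ _ _ snd (fun y => (Z y)^-1)); first exact: measurable_snd.
by apply: bmeasV z0p zP _; exact: bmeas_partition.
Qed.

Let Zgt0 y : 0 < Z y. Proof. exact: (partition_gt0 bmu mmu0 mmu mu1 eps0). Qed.

Lemma schrodinger_plan_ge0 z : 0 <= schrodinger_plan z.
Proof.
apply: mulr_ge0; last by rewrite invr_ge0 ltW.
exact/ltW/(gibbs_weight_gt0 mmu0 mmu eps0).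
Qed.

Let bw y : bmeas (fun x => gibbs_weight mu eps phi (x, y)).
Proof. exact: bmeas_pair1 (bmeas_gibbs_weight bmu eps0 bphi). Qed.

Lemma schrodinger_plan_int1 y : \int[cube_meas d]_x schrodinger_plan (x, y) = 1.
Proof.
transitivity (\int[cube_meas d]_x ((Z y)^-1 * gibbs_weight mu eps phi (x, y))).
  by apply: eq_Rintegral => x _; rewrite /schrodinger_plan mulrC.
apply: (etrans (bmeas_intZ _ _ (bw y))); apply: mulVf; exact: lt0r_neq0.
Qed.

(** This is the Schroedinger system: [psiE] gives [(Z y)^-1 = expR (psi y / eps)], after which the
    integral in [y] is the partition function of [psi] at [x], equal to [expR (- phi x / eps)] by
    [phiE]. *)
Lemma schrodinger_plan_int2 x :
  \int[cube_meas d]_y (schrodinger_plan (x, y) * nu y) = mu x.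
Proof.
have psiV y : (Z y)^-1 = expR (psi y / eps).
  rewrite psiE (tor_cT_muE bmu eps0 y bphi) -/Z.
  rewrite mulNr [eps * _]mulrC mulNr mulfK ?gt_eqF// expRN lnK//.
  exact: Zgt0.
have [Z' [Z'0 phix bw' I']] := cT_partition bnu mnu0 mnu nu1 eps0 x bpsi.
transitivity (\int[cube_meas d]_y (expR (phi x / eps) * mu x * gibbs_weight nu eps psi (y, x))).
  apply: eq_Rintegral => y _; rewrite /schrodinger_plan /= psiV /gibbs_weight /=.
  have -> : tor_heat_kernel eps (y - x) = @tor_heat_kernel R d eps (x - y).
    by rewrite -heat_kernelN opprB.
  by move: (tor_heat_kernel _ _) => k; ring.
apply: (etrans (bmeas_intZ _ _ bw')); rewrite I'.
have -> : phi x / eps = - ln Z'.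
  by rewrite phiE phix mulNr [eps * _]mulrC mulNr mulfK// gt_eqF.
rewrite expRN lnK ?posrE// [_ * mu x]mulrC mulfVK// gt_eqF//.
Qed.

(** Tilting the weight of [phi] by [expR (chi x / eps)] gives the weight of [phi + chi], so the
    moment is a ratio of partition functions. *)
Lemma schrodinger_plan_log_moment (chi : borelV R d -> R) y : bmeas chi ->
  tor_cT_mu mu eps (fun x => phi x + chi x) y - tor_cT_mu mu eps phi y =
  - (eps * ln (\int[cube_meas d]_x (expR (chi x / eps) * schrodinger_plan (x, y)))).
Proof.
move=> bchi; have b1 : bmeas (fun x => phi x + chi x) by exact: bmeasD.
have [Z1 [Z10 -> bw1 I1]] := cT_partition bmu mmu0 mmu mu1 eps0 y b1.
rewrite (tor_cT_muE bmu eps0 y bphi) -/Z.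
have -> : \int[cube_meas d]_x (expR (chi x / eps) * schrodinger_plan (x, y)) = (Z y)^-1 * Z1.
  rewrite -I1 -(bmeas_intZ _ _ bw1); apply: eq_Rintegral => x _.
  rewrite /schrodinger_plan /gibbs_weight /= mulrDl expRD.
  by move: (tor_heat_kernel _ _) (Z y)^-1 => k z; ring.
rewrite lnM ?posrE ?invr_gt0// lnV ?posrE//.
by ring.
Qed.

End schrodinger.

Lemma coef_arith {R : realType} (eps a C C' : R) : 0 < eps -> C <= C' ->
  2 * eps + 3 * a + a ^+ 2 / eps + C <= 4 * eps + C' + 8 * a ^+ 2 / (3 * eps).
Proof.
move=> eps0 CC'.
have aE : a = a / eps * eps by rewrite divfK// gt_eqF.
move: aE; set b := a / eps => ->.
have -> : (b * eps) ^+ 2 / eps = b ^+ 2 * eps by field; rewrite gt_eqF.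
have -> : 8 * (b * eps) ^+ 2 / (3 * eps) = 8 / 3 * b ^+ 2 * eps by field; rewrite gt_eqF.
(* Apart from [C' - C], this is the difference of the two sides; the quadratic in [b] has negative
   discriminant. *)
have : 0 <= (2 - 3 * b + 5 / 3 * b ^+ 2) * eps.
  by rewrite mulr_ge0 ?(ltW eps0)//; have := sqr_ge0 (b - 9 / 10); nra.
lra.
Qed.

Lemma tor_osc_ge0 {R : realType} {d : nat} (f : 'rV[R]_d -> R) :
  tor_periodic f -> continuous f -> 0 <= tor_osc f.
Proof. by move=> pf cf; have := tor_osc_le 0 0 pf cf; rewrite subrr normr0. Qed.

(** The inequality for one potential, with the constant that the argument yields. Nonnegativity of
    the gap is returned as well, because the coefficient is enlarged afterwards. *)
Lemma semidual_strong_concavity (R : realType) (d : nat) (mu nu phi psi chi : 'rV[R]_d -> R)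
    (m_mu M_mu m_nu M_nu eps : R) :
  0 < m_mu -> 0 < m_nu -> 0 < M_nu ->
  tor_bounded_density mu m_mu M_mu -> tor_bounded_density nu m_nu M_nu -> 0 < eps ->
  tor_periodic phi -> continuous phi -> tor_periodic psi -> continuous psi ->
  (forall f, tor_periodic f -> continuous f ->
     tor_Ifun mu nu eps f <= tor_Ifun mu nu eps phi) ->
  phi = tor_cT_mu nu eps psi -> psi = tor_cT_mu mu eps phi ->
  continuous chi -> tor_periodic chi ->
  0 <= tor_Ifun mu nu eps phi - tor_Ifun mu nu eps (phi \+ chi) /\
  tor_variance mu chi <=
    (2 * eps + 3 * tor_osc chi + tor_osc chi ^+ 2 / eps + M_nu / m_nu * poinc_cst R d)
    * (tor_Ifun mu nu eps phi - tor_Ifun mu nu eps (phi \+ chi)).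
Proof.
have l01 : 0 <= (2^-1 : R) <= 1 by apply/andP; split; lra.
move=> mmu0 mnu0 Mnu0 dmu dnu eps0 pphi cphi ppsi cpsi opt phiE psiE cchi pchi.
have bmu := density_bmeas mmu0 dmu; have mu1 := density_int1 mmu0 dmu.
have bnu := density_bmeas mnu0 dnu; have nu1 := density_int1 mnu0 dnu.
have nuP : forall y, m_nu <= nu y <= M_nu by have [] := dnu.
have mmu x : m_mu <= mu x by have [_ _ H _] := dmu; have /andP[] := H x.
have mnu x : m_nu <= nu x by have /andP[] := nuP x.
have bphi := periodic_continuous_bmeas pphi cphi.
have bpsi := periodic_continuous_bmeas ppsi cpsi.
have bchi := periodic_continuous_bmeas pchi cchi.
have pD (f g : 'rV[R]_d -> R) : tor_periodic f -> tor_periodic g -> tor_periodic (f \+ g).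
  by move=> pf pg x k; rewrite /= pf pg.
have cD (f g : 'rV[R]_d -> R) : continuous f -> continuous g -> continuous (f \+ g).
  by move=> cf cg x; exact: (continuousD (cf x) (cg x)).
(* Half the perturbation: the competitor [phi + chi / 2] is the midpoint at which maximality of
   [phi] is tested. *)
pose hchi (x : 'rV[R]_d) := 2^-1 * chi x.
have phchi : tor_periodic hchi by move=> x k; rewrite /hchi pchi.
have chchi : continuous hchi.
  move=> x; apply: (continuousM (s := fun=> 2^-1) _ (cchi x)).
  exact: cst_continuous.
have b1 : bmeas ((phi \+ chi) : borelV R d -> R) by exact: bmeasD.
have bh : bmeas ((phi \+ hchi) : borelV R d -> R).
  by apply: bmeasD => //; exact: bmeasZ.
have bT (f : borelV R d -> R) : bmeas f -> bmeas (tor_cT_mu mu eps f : borelV R d -> R).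
  exact: bmeas_cT bmu mmu0 mmu mu1 eps0 f.
have o1 : tor_Ifun mu nu eps (phi \+ chi) <= tor_Ifun mu nu eps phi.
  by apply: opt; [exact: pD|exact: cD].
have oh : tor_Ifun mu nu eps (phi \+ hchi) <= tor_Ifun mu nu eps phi.
  by apply: opt; [exact: pD|exact: cD].
split; first by rewrite subr_ge0.
(* Joint semiconcavity at weight [2^-1] between [phi] at [y - w] and [phi + chi] at [y + w]; the
   distance [2 * w] turns the correction [1/8] into [1/2]. *)
have gap : conc_gap (tor_cT_mu mu eps phi) (tor_cT_mu mu eps (phi \+ chi))
    (fun y => tor_cT_mu mu eps (phi \+ hchi) y
      - 2^-1 * (tor_cT_mu mu eps phi y + tor_cT_mu mu eps (phi \+ chi) y)).
  move=> y w.
  have := cT_joint_semiconcave bmu mmu0 mmu mu1 eps0 (y - w) (y + w) bphi b1 l01.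
  have -> : (fun x => (1 - 2^-1) * phi x + 2^-1 * (phi \+ chi) x) = phi \+ hchi.
    by apply/funext => x; rewrite /hchi /=; field.
  have -> : (1 - 2^-1) *: (y - w) + 2^-1 *: (y + w) = y.
    by apply/rowP => i; rewrite !mxE; field.
  have -> : sqnorm (y - w - (y + w)) = 4 * sqnorm w.
    by rewrite /sqnorm mulr_sumr; apply: eq_bigr => i _; rewrite !mxE; ring.
  move: (tor_cT_mu mu eps (phi \+ hchi)) (tor_cT_mu mu eps (phi \+ chi)).
  move: (tor_cT_mu mu eps phi) => t0 th t1; lra.
rewrite (tor_varianceE bmu bchi).
move: o1 oh gap; rewrite (tor_IfunE bmu bnu bphi (bT _ bphi)).
rewrite (tor_IfunE bmu bnu b1 (bT _ b1)) (tor_IfunE bmu bnu bh (bT _ bh)).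
have key := gibbs_mixture_variance (bmeas_schrodinger_plan bmu mmu0 mmu mu1 eps0 bphi)
  (schrodinger_plan_ge0 bmu mmu0 mmu mu1 eps0 bphi)
  (schrodinger_plan_int1 bmu mmu0 mmu mu1 eps0 bphi)
  (schrodinger_plan_int2 bmu mmu0 mmu bnu mnu0 mnu mu1 nu1 eps0 bphi bpsi phiE psiE)
  bnu (fun y => le_trans (ltW mnu0) (mnu y)) bmu mu1 bchi
  (fun x y => tor_osc_le x y pchi cchi) (tor_osc_ge0 pchi cchi) eps0
  (bmeasB (bT _ b1) (bT _ bphi))
  (fun y => schrodinger_plan_log_moment bmu mmu0 mmu mu1 eps0 bphi y bchi).
have bT0 := bT _ bphi; have bT1 := bT _ b1; have bTh := bT _ bh.
have P0 := periodic_cT bmu eps0 bphi; have P1 := periodic_cT bmu eps0 b1.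
have S0 := semiconcave_cT bmu mmu0 mmu mu1 eps0 bphi.
have S1 := semiconcave_cT bmu mmu0 mmu mu1 eps0 b1.
move: bT0 bT1 bTh P0 P1 S0 S1 key; rewrite -/(phi \+ chi).
(* From here on the three transforms are abstract functions, known only through the properties just
   collected. *)
move: (tor_cT_mu mu eps (phi \+ hchi)) (tor_cT_mu mu eps (phi \+ chi)).
move: (tor_cT_mu mu eps phi) => g0 gh g1 bg0 bg1 bgh p0 p1 s0 s1 key o1 oh gap.
have bpm : bmeas (fun x : borelV R d => phi x * mu x) by exact: bmeasM.
have bcm : bmeas (fun x : borelV R d => chi x * mu x) by exact: bmeasM.
have bn (g : borelV R d -> R) : bmeas g -> bmeas (fun y => g y * nu y).
  by move=> bg; exact: bmeasM.
have I1 : \int[cube_meas d]_x ((phi \+ chi) x * mu x) =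
    \int[cube_meas d]_x (phi x * mu x) + \int[cube_meas d]_x (chi x * mu x).
  by rewrite -bmeas_intD//; apply: eq_Rintegral => x _; rewrite mulrDl.
have Ih : \int[cube_meas d]_x ((phi \+ hchi) x * mu x) =
    \int[cube_meas d]_x (phi x * mu x) + 2^-1 * \int[cube_meas d]_x (chi x * mu x).
  rewrite -(bmeas_intZ _ _ bcm) -bmeas_intD//; last exact: bmeasZ.
  by apply: eq_Rintegral => x _; rewrite /hchi /= mulrDl mulrA.
have Iu : \int[cube_meas d]_y ((g1 y - g0 y) * nu y) =
    \int[cube_meas d]_y (g1 y * nu y) - \int[cube_meas d]_y (g0 y * nu y).
  rewrite -(bmeas_intB _ (bn _ bg1) (bn _ bg0)).
  by apply: eq_Rintegral => y _; rewrite mulrBl.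
have Id : \int[cube_meas d]_y ((gh y - 2^-1 * (g0 y + g1 y)) * nu y) =
    \int[cube_meas d]_y (gh y * nu y) - 2^-1 * (\int[cube_meas d]_y (g0 y * nu y)
      + \int[cube_meas d]_y (g1 y * nu y)).
  rewrite -(bmeas_intD _ (bn _ bg0) (bn _ bg1)).
  rewrite -(bmeas_intZ _ _ (bmeasD (bn _ bg0) (bn _ bg1))).
  rewrite -(bmeas_intB _ (bn _ bgh) (bmeasZ _ (bmeasD (bn _ bg0) (bn _ bg1)))).
  by apply: eq_Rintegral => y _; ring.
rewrite I1 in o1 *; rewrite Ih in oh; rewrite Iu in key.
apply: (weighted_conc_gap_variance bg0 bg1 _ bnu p0 p1 s0 s1 gap mnu0 Mnu0 nuP).
- by apply: bmeasB => //; apply: bmeasZ; exact: bmeasD.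
- move=> c; apply: le_trans (key c) _; rewrite lerD2r le_eqVlt; apply/orP; left.
  by apply/eqP; congr (_ * _); ring.
(* Maximality against [phi + chi / 2] bounds the integral of its transform; subtracting the mean of
   the two end transforms leaves half the gap. *)
- by rewrite Id; lra.
Qed.

Theorem theorem3p1 (R : realType) :
  exists Cmu Cnu : R -> R -> nat -> R,
    (forall m M d, 0 < Cmu m M d) /\ (forall m M d, 0 < Cnu m M d) /\
    forall (d : nat) (alpha Rad : R) (mu nu : 'rV[R]_d -> R)
           (m_mu M_mu m_nu M_nu eps : R) (phi psi : 'rV[R]_d -> R),
      (0 < d)%N -> 0 < alpha -> 0 < Rad ->
      tor_strongly_convex_on alpha (tor_tball (0 : 'rV[R]_d) Rad) (fun x => tor_tdist 0 x ^+ 2) ->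
      0 < m_mu -> 0 < M_mu -> 0 < m_nu -> 0 < M_nu ->
      tor_bounded_density mu m_mu M_mu -> tor_bounded_density nu m_nu M_nu ->
      0 < eps ->
      tor_schrodinger_potentials mu nu eps phi psi ->
      (forall chi : 'rV[R]_d -> R, continuous chi -> tor_periodic chi ->
         tor_variance mu chi <=
           (4 * eps + Cnu m_nu M_nu d * expR (2 * Rad ^+ 2 / alpha + 8 * pi ^+ 2 * d%:R)
            + 8 * tor_osc chi ^+ 2 / (3 * eps))
           * (tor_Ifun mu nu eps phi - tor_Ifun mu nu eps (phi \+ chi))) /\
      (forall eta : 'rV[R]_d -> R, continuous eta -> tor_periodic eta ->
         tor_variance nu eta <=
           (4 * eps + Cmu m_mu M_mu d * expR (2 * Rad ^+ 2 / alpha + 8 * pi ^+ 2 * d%:R)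
            + 8 * tor_osc eta ^+ 2 / (3 * eps))
           * (tor_Ibar mu nu eps psi - tor_Ibar mu nu eps (psi \+ eta))).
Proof.
(* The absolute value and the added 1 make the constant positive for all real arguments, as the
   statement asks. *)
pose C (m M : R) d := `|M / m| * poinc_cst R d + 1.
have C0 m M d : 0 < C m M d.
  by rewrite ltr_wpDl// mulr_ge0// ltW// poinc_cst_gt0.
exists C, C; split; [exact: C0|split; [exact: C0|]].
move=> d alpha Rad mu nu m_mu M_mu m_nu M_nu eps phi psi _ al0 Rad0 _.
move=> mmu0 Mmu0 mnu0 Mnu0 dmu dnu eps0 [[pphi cphi] [ppsi cpsi] opt optbar [phiE psiE]].
rewrite tor_cT_nuE in phiE.
have IbarE g : tor_Ibar mu nu eps g = tor_Ifun nu mu eps g.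
  by rewrite /tor_Ibar /tor_Ifun tor_cT_nuE addrC.
(* Multiplying [C] by an exponential that is at least 1 preserves the upper bound. *)
have e1 : 1 <= expR (2 * Rad ^+ 2 / alpha + 8 * pi ^+ 2 * d%:R).
  rewrite -expR0 ler_expR addr_ge0//.
    by rewrite mulr_ge0 ?invr_ge0 ?(ltW al0)// mulr_ge0 ?sqr_ge0.
  by rewrite mulr_ge0// mulr_ge0 ?sqr_ge0.
have CC m M : 0 < m -> 0 < M -> M / m * poinc_cst R d <=
    C m M d * expR (2 * Rad ^+ 2 / alpha + 8 * pi ^+ 2 * d%:R).
  move=> m0 M0; apply: (@le_trans _ _ (C m M d)).
    have q0 : 0 <= M / m by apply: divr_ge0; exact: ltW.
    by rewrite /C (ger0_norm q0) lerDl.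
  by rewrite ler_peMr// ltW.
split=> chi cchi pchi.
  have [G0 V] := semidual_strong_concavity mmu0 mnu0 Mnu0 dmu dnu eps0 pphi cphi ppsi cpsi
    opt phiE psiE cchi pchi.
  by apply: (le_trans V); apply: ler_wpM2r => //; apply: coef_arith => //; exact: CC.
(* Through [IbarE], maximality of [psi] becomes the hypothesis of the first case with [mu] and [nu]
   exchanged. *)
have optI f : tor_periodic f -> continuous f ->
    tor_Ifun nu mu eps f <= tor_Ifun nu mu eps psi.
  by move=> pf cf; rewrite -!IbarE; exact: optbar.
have [G0 V] := semidual_strong_concavity mnu0 mmu0 Mmu0 dnu dmu eps0 ppsi cpsi pphi cphi
  optI psiE phiE cchi pchi.
by rewrite !IbarE; apply: (le_trans V); apply: ler_wpM2r => //; apply: coef_arith => //;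
  exact: CC.
Qed.
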